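(* Consider two independent simple random walks on the Erdős–Rényi random graph $\mathcal{G}(n,p_n)$, where the edge probability is $p_n=\min(cn^{\beta-1},1)$ with $c>0$ arbitrary but fixed. Let $\beta>\frac12$. Then for all $\epsilon>0$ there exist $N\in\mathbb{N}$ and constants $\nu_1,\nu_2,\theta>0$ such that for all $n\ge N$, $$\mathbb{P}\left(\left|\frac1n t^{\pi}_{\mathrm{meet}}-1\right|>\epsilon\right)\le 2n\exp\left(-\frac{\nu_1^2d}{3}\right)+2\binom n2\exp\left(-\frac{\nu_2^2d^2}{3n}\right)+e^{-\theta(\log n)^2},$$ where $d:=np_n$ is the mean degree. In particular, the right-hand side converges to zero as $n\to\infty$.
   Context: $\mathcal{G}(n,p)$ is the random graph on vertex set $[n]=\{1,\dots,n\}$ whose symmetric adjacency matrix $A=(a_{i,j})$ has independent Bernoulli$(p)$ entries $(a_{i,j})_{i<j}$ and $a_{i,i}=0$. $\mathbb{P}$ denotes the law of the random graph. The simple random walk on the graph has transition matrix $P_{ij}=a_{i,j}/\deg i$ and invariant distribution $\pi$, $\pi_i=\deg i/\sum_{k}\deg k$. Given the graph, let $(X_t)$, $(Y_t)$ be independent discrete-time simple random walks started at vertices $i$ and $j$ respectively; $\tau_{\mathrm{meet}}(i,j)=\inf\{t\in\mathbb{Z}_{\ge0}:X_t=Y_t\}$ (with $\tau_{\mathrm{meet}}(i,j)=\infty$ if they never meet). The expected meeting time from stationarity is $t^{\pi}_{\mathrm{meet}}=\sum_{i,j}\pi_i\pi_j\,\mathbf{E}[\tau_{\mathrm{meet}}(i,j)]$,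 where $\mathbf{E}$ is the expectation with respect to the law of the random walks on the given graph. *)

(* Defs.v *)
From HB Require Import structures.
From mathcomp Require Import all_boot all_order all_algebra.
From mathcomp Require Import all_classical all_reals all_analysis.
From mathcomp Require Import ring lra.

Set Implicit Arguments.
Unset Strict Implicit.
Unset Printing Implicit Defensive.

Import Order.TTheory GRing.Theory Num.Theory.
Import numFieldNormedType.Exports.
Local Open Scope classical_set_scope.
Local Open Scope ring_scope.

Definition is_adjacency (n : nat) (A : 'M[bool]_n) : bool :=
  (A^T == A) && [forall i, ~~ A i i].

Record graph (n : nat) := Graph {
  adj :> 'M[bool]_n;
  _ : is_adjacency adj }.

HB.instance Definition _ (n : nat) := [isSub for @adj n].
HB.instance Definition _ (n : nat) := [Finite of graph n by <:].

Section erdos_renyi.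
Context {R : realType}.

Definition er_mass (n : nat) (p : R) (G : graph n) : R :=
  \prod_(i < n) \prod_(j < n | (i < j)%N) bernoulli_pmf p (adj G i j).

Definition er_prob (n : nat) (p : R) (E : pred (graph n)) : R :=
  \sum_(G : graph n | E G) er_mass p G.

End erdos_renyi.

Section random_walk.
Context {R : realType} {n : nat}.
Implicit Types (G : graph n) (i j : 'I_n).

Definition deg G i : nat := (\sum_(j < n) adj G i j)%N.

(* The walk stays put at isolated vertices, where a_ij / deg i would be 0 / 0;
   without this the matrix is not stochastic and such a walk does not exist.
   These vertices have weight 0 under [stationary] and are never reached from
   a vertex that is not isolated. *)
Definition transition G i j : R :=
  if deg G i == 0%N then (i == j)%:R else (adj G i j)%:R / (deg G i)%:R.

Definition stationary G i : R := (deg G i)%:R / (\sum_(k < n) deg G k)%N%:R.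

Definition cylinder (T : Type) (X : nat -> T -> 'I_n) (t : nat)
    (x : nat -> 'I_n) : set T :=
  [set w | forall s, (s <= t)%N -> X s w = x s].

(* The step equation is the Markov property
   P(X_{t+1} = x_{t+1} | X_0 = x_0, ..., X_t = x_t) = transition x_t x_{t+1}
   with the denominator cleared. *)
Definition is_random_walk d (T : measurableType d) (P : probability T R)
    (X : nat -> T -> 'I_n) G i : Prop :=
  [/\ forall t v, measurable [set w | X t w = v],
      P [set w | X 0%N w = i] = 1%E
    & forall t x, P (cylinder X t.+1 x) =
        (P (cylinder X t x) * (transition G (x t) (x t.+1))%:E)%E].

(* Independence is stated on the finite-dimensional path events, which form a
   pi-system generating the sigma-algebra of a process with finite state
   space. *)
Definition independent_processes d (T : measurableType d)
    (P : probability T R) (X Y : nat -> T -> 'I_n) : Prop :=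
  forall t x y, P (cylinder X t x `&` cylinder Y t y) =
    (P (cylinder X t x) * P (cylinder Y t y))%E.

Record walk_pair G i j := WalkPair {
  wp_disp : measure_display;
  wp_space : measurableType wp_disp;
  wp_prob : probability wp_space R;
  wp_X : nat -> wp_space -> 'I_n;
  wp_Y : nat -> wp_space -> 'I_n;
  wp_X_walk : is_random_walk wp_prob wp_X G i;
  wp_Y_walk : is_random_walk wp_prob wp_Y G j;
  wp_indep : independent_processes wp_prob wp_X wp_Y }.

Arguments wp_X {G i j} w _ _.
Arguments wp_Y {G i j} w _ _.

(* [ereal_inf set0 = +oo]: the walks may never meet. *)
Definition meeting_time G i j (W : walk_pair G i j) (w : wp_space W) : \bar R :=
  ereal_inf [set t%:R%:E | t in [set t | wp_X W t w = wp_Y W t w]].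

Definition expected_meeting_time G i j (W : walk_pair G i j) : \bar R :=
  (\int[wp_prob W]_w meeting_time w)%E.

(* In [\bar R], [0 * +oo = 0]. *)
Definition stationary_meeting_time G (W : forall i j, walk_pair G i j) : \bar R :=
  (\sum_(i < n) \sum_(j < n)
     (stationary G i * stationary G j)%:E * expected_meeting_time (W i j))%E.

End random_walk.

Arguments walk_pair R {n} G i j.

(* Walk pairs exist, so quantifying over all of them is not vacuous.  Each walk
   reads its steps off one coordinate of the unit square: [0, 1[ is cut into
   intervals of lengths [Q z k], and the position inside the chosen interval,
   rescaled to [0, 1[, drives the next step. *)
Module WalkPairExistence.

Section chain_on_unit_interval.
Context {R : realType} {n : nat} (Q : 'I_n -> 'I_n -> R).
Hypothesis Q0 : forall z k, 0 <= Q z k.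
Hypothesis Q1 : forall z, \sum_k Q z k = 1.

Definition F z (k : nat) : R := \sum_(r < n | (r < k)%N) Q z r.

Lemma F_ge0 z k : 0 <= F z k.
Proof. exact: sumr_ge0. Qed.

Lemma FS z (k : 'I_n) : F z k.+1 = F z k + Q z k.
Proof.
rewrite /F (bigD1 k) ?ltnS//= addrC; congr (_ + _).
by apply: eq_bigl => r; rewrite ltnS ltn_neqAle andbC.
Qed.

Lemma F_le z k l : (k <= l)%N -> F z k <= F z l.
Proof.
move=> kl; rewrite /F big_mkcond [leRHS]big_mkcond /=; apply: ler_sum => r _.
case: ifPn => rk; first by rewrite (leq_trans rk kl).
by case: ifP.
Qed.

Lemma F_le1 z k : F z k <= 1.
Proof. by rewrite -(Q1 z) [leRHS]big_mkcond /F [leLHS]big_mkcond /=; apply: ler_sum => r _; case: ifP. Qed.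

Lemma Fn z : F z n = 1.
Proof. by rewrite -(Q1 z); apply: eq_bigl => r; rewrite ltn_ord. Qed.

Definition sel z u : 'I_n := odflt z [pick k : 'I_n | F z k <= u < F z k + Q z k].

Lemma selP z u (k : 'I_n) : 0 <= u < 1 -> (sel z u = k) <-> (F z k <= u < F z k + Q z k).
Proof.
move=> /andP[u0 u1].
have uniq (k1 k2 : 'I_n) : F z k1 <= u < F z k1 + Q z k1 ->
    F z k2 <= u < F z k2 + Q z k2 -> k1 = k2.
  rewrite -!FS => /andP[a1 b1] /andP[a2 b2]; apply/val_inj => /=.
  case: (ltngtP k1 k2) => // h; exfalso.
    by have := F_le z h; lra.
  by have := F_le z h; lra.
have ex : exists k0 : 'I_n, F z k0 <= u < F z k0 + Q z k0.
  have : exists m, u < F z m by exists n; rewrite Fn.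
  move=> /ex_minnP[[|m] um mmin].
    by move: um; rewrite /F big_pred0 ?ltNge ?u0.
  have mn : (m < n)%N by apply: mmin; rewrite Fn.
  exists (Ordinal mn); rewrite -FS um andbT leNgt; apply/negP => /mmin.
  by rewrite ltnn.
rewrite /sel; case: pickP => [k' hk'|] /=.
  by split=> [<-//|]; exact: uniq.
by case: ex => k0 hk0 /(_ k0); rewrite hk0.
Qed.

Definition step (p : 'I_n * R) : 'I_n * R :=
  let k := sel p.1 p.2 in (k, (p.2 - F p.1 k) / Q p.1 k).

Definition Z t z u := (iter t step (z, u)).1.

Definition wt (x : nat -> 'I_n) t : R := \prod_(s < t) Q (x s) (x s.+1).

Lemma wt_ge0 x t : 0 <= wt x t.
Proof. exact: prodr_ge0. Qed.

Lemma Z_itv t x : exists a, [/\ 0 <= a, a + wt x t <= 1 &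
  forall u, 0 <= u < 1 ->
   (forall s, (s <= t)%N -> Z s (x 0%N) u = x s) <-> (a <= u < a + wt x t)].
Proof.
elim: t x => [|t IH] x.
  exists 0; rewrite /wt big_ord0; split; rewrite ?lerr ?add0r// => u u01.
  by split=> // _ [].
have [a [a0 a1 ha]] := IH (fun s => x s.+1).
set q := Q (x 0%N) (x 1%N); set f := F (x 0%N) (x 1%N).
have wtS : wt x t.+1 = q * wt (fun s => x s.+1) t by rewrite /wt big_ord_recl.
have q0 : 0 <= q by exact: Q0.
have f0 : 0 <= f by exact: F_ge0.
have fq : f + q <= 1 by rewrite -FS F_le1.
set w := wt _ t in a1 ha wtS.
have w0 : 0 <= w by exact: wt_ge0.
exists (f + q * a); rewrite wtS; split; [nra|nra|].
move=> u u01.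
have -> : (f + q * a <= u < f + q * a + q * w) <->
    (f <= u < f + q) /\ (a <= (u - f) / q < a + w).
  have [qz|qn] := eqVneq q 0.
    rewrite qz; split => [|[]]; rewrite !mul0r !addr0 => /andP[h1 h2]; lra.
  have qp : 0 < q by rewrite lt_neqAle eq_sym qn.
  rewrite ler_pdivlMr// ltr_pdivrMr//.
  split=> [/andP[h1 h2]|[/andP[h1 h2] /andP[h3 h4]]].
    split; apply/andP; split; nra.
  by apply/andP; split; nra.
split=> [h|[fu au]].
  have h1 := h 1%N isT; rewrite /Z /= in h1.
  have hf := h1; move/(selP _ _ u01) : hf; rewrite -/f -/q => fu; split=> //.
  have u'01 : 0 <= (u - f) / q < 1.
    have qp : 0 < q by move: fu => /andP[]; lra.
    rewrite ler_pdivlMr// ltr_pdivrMr//; move: fu => /andP[]; lra.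
  apply/(ha _ u'01) => s st.
  by rewrite -(h s.+1 st) /Z iterSr /step /= h1.
have u'01 : 0 <= (u - f) / q < 1 by move: au => /andP[]; lra.
case=> // s st.
have h1 : sel (x 0%N) u = x 1%N by apply/selP.
have /(_ s st) <- := (ha _ u'01).2 au.
by rewrite /Z iterSr /step /= h1.
Qed.

Definition clamp (u : R) : R := if (0 <= u < 1) then u else 0.

Lemma clamp01 u : 0 <= clamp u < 1.
Proof. by rewrite /clamp; case: ifPn => // _; rewrite lexx ltr01. Qed.

Lemma measurable_clamp : measurable_fun setT clamp.
Proof.
apply: measurable_fun_if => //=.
by apply: measurable_and => //; [exact: measurable_realfun.measurable_fun_ler|exact: measurable_realfun.measurable_fun_ltr].
Qed.

Definition mu01 := mrestr (@lebesgue_measure R) (@measurable_itv R `[0, 1[).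
HB.instance Definition _ := Measure.on mu01.
Lemma mu01T : mu01 setT = 1%E.
Proof. by rewrite /mu01 /mrestr setTI lebesgue_measure_itv/= lte01 sube0. Qed.
HB.instance Definition _ := @Measure_isProbability.Build _ _ R mu01 mu01T.

Definition Xw i t u := Z t i (clamp u).

Lemma cylE i t x : x 0%N = i -> exists a, [/\ 0 <= a, a + wt x t <= 1 &
  cylinder (Xw i) t x = clamp @^-1` `[a, a + wt x t[ ].
Proof.
move=> x0; have [a [a0 a1 ha]] := Z_itv t x; exists a; split=> //.
apply/seteqP; split=> u /=; rewrite in_itv /=; rewrite /cylinder /= /Xw -x0.
  by move=> h; apply/(ha _ (clamp01 u)).
by move=> h; apply/(ha _ (clamp01 u)).
Qed.

Lemma cyl0 i t x : x 0%N <> i -> cylinder (Xw i) t x = set0.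
Proof. by move=> x0; rewrite -subset0 => u /(_ 0%N isT)/esym. Qed.

Lemma mcyl i t x : measurable (cylinder (Xw i) t x).
Proof.
have [/cylE-/(_ t)[a [_ _ ->]]|/cyl0->//] := pselect (x 0%N = i).
by rewrite -[X in measurable X]setTI; apply: measurable_clamp.
Qed.

Lemma Pcyl i t x : mu01 (cylinder (Xw i) t x) = ((x 0%N == i)%:R * wt x t)%:E.
Proof.
have [x0|/eqP/cyl0->] := eqVneq; last by rewrite measure0 mul0r.
have [a [a0 a1 ->]] := cylE t x0; rewrite mul1r /mu01 /mrestr.
rewrite (_ : _ `&` _ = `[a, a + wt x t[%classic); last first.
  apply/seteqP; split=> u /=; rewrite !in_itv /=.
    by move=> [h u01]; move: h; rewrite /clamp u01.
  move=> h; have u01 : 0 <= u < 1 by move: h => /andP[]; lra.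
  by rewrite /clamp u01.
rewrite lebesgue_measure_itv/= lte_fin.
have := wt_ge0 x t; case: ifPn => [_ _|h w0]; first by rewrite -EFinB addrC addKr.
by congr EFin; move: h; rewrite -leNgt; lra.
Qed.

Lemma mXw i t v : measurable [set u | Xw i t u = v].
Proof.
rewrite (_ : mkset _ = \bigcup_(x in [set x : {ffun 'I_t.+1 -> 'I_n} | x ord_max = v])
   cylinder (Xw i) t (fun s => x (inord s))); last first.
  apply/seteqP; split=> u /=.
    move=> h; exists [ffun s : 'I_t.+1 => Xw i s u] => /=; first by rewrite ffunE.
    by move=> s st; rewrite ffunE inordK.
  by move=> [x /= <-] /(_ t (leqnn t)) ->; congr (x _); apply/val_inj; rewrite /= inordK.
by apply: fin_bigcup_measurable => // x _; exact: mcyl.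
Qed.
End chain_on_unit_interval.

Section product_space.
Context {R : realType}.
Definition prodP := (@mu01 R \x @mu01 R)%E.
HB.instance Definition _ := Measure.on prodP.
Lemma prodPT : prodP setT = 1%E.
Proof. by rewrite -setXTT /prodP product_measure1E//= mu01T mule1. Qed.
HB.instance Definition _ := @Measure_isProbability.Build _ _ R prodP prodPT.

End product_space.

Section existence.
Context {R : realType} {n : nat}.
Variable (G : graph n).
Let tr := @transition R n G.

Lemma tr0 z k : 0 <= tr z k.
Proof. by rewrite /tr /transition; case: ifP. Qed.

Lemma tr1 z : \sum_k tr z k = 1.
Proof.
rewrite /tr /transition; have [d0|dn] := eqVneq (deg G z) 0%N.
  by rewrite (bigD1 z)//= eqxx big1 ?addr0// => k; rewrite eq_sym => /negbTE ->.
by rewrite -mulr_suml -natr_sum divff// pnatr_eq0.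
Qed.

Theorem walk_pair_exists i j : inhabited (walk_pair R G i j).
Proof.
have wtS x t : wt tr x t.+1 = wt tr x t * tr (x t) (x t.+1) by rewrite /wt big_ord_recr.
pose X t (w : R * R) := Xw tr i t w.1.
pose Y t (w : R * R) := Xw tr j t w.2.
have mc := mcyl tr0 tr1; have mX := mXw tr0 tr1.
have cX t x : cylinder X t x = cylinder (Xw tr i) t x `*` setT.
  by apply/seteqP; split=> -[u v] //= [].
have cY t x : cylinder Y t x = setT `*` cylinder (Xw tr j) t x.
  by apply/seteqP; split=> -[u v] //= [].
have PX t x : @prodP R (cylinder X t x) = ((x 0%N == i)%:R * wt tr x t)%:E.
  rewrite cX /prodP product_measure1E//=; last exact: mc.
  by rewrite mu01T mule1 Pcyl//; (exact: tr0 || exact: tr1).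
have PY t x : @prodP R (cylinder Y t x) = ((x 0%N == j)%:R * wt tr x t)%:E.
  rewrite cY /prodP product_measure1E//=; last exact: mc.
  by rewrite mu01T mul1e Pcyl//; (exact: tr0 || exact: tr1).
constructor; apply: (@WalkPair R n G i j _ _ (@prodP R) X Y).
- split.
  + move=> t v; rewrite (_ : mkset _ = [set u | Xw tr i t u = v] `*` setT).
      by apply: measurableX => //; exact: mX.
    by apply/seteqP; split=> -[a b] //= [].
  + have -> : [set w | X 0%N w = i] = setT by apply/seteqP; split.
    exact: prodPT.
  + move=> t x; apply: (etrans (PX _ _)); rewrite wtS mulrA EFinM.
    by congr (_ * _)%E; exact/esym/PX.
- split.
  + move=> t v; rewrite (_ : mkset _ = setT `*` [set u | Xw tr j t u = v]).
      by apply: measurableX => //; exact: mX.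
    by apply/seteqP; split=> -[a b] //= [].
  + have -> : [set w | Y 0%N w = j] = setT by apply/seteqP; split.
    exact: prodPT.
  + move=> t x; apply: (etrans (PY _ _)); rewrite wtS mulrA EFinM.
    by congr (_ * _)%E; exact/esym/PY.
- move=> t x y.
  have h : (@prodP R (cylinder X t x `&` cylinder Y t y) =
      @prodP R (cylinder X t x) * @prodP R (cylinder Y t y))%E.
    rewrite PX PY cX cY -setXI setTI setIT /prodP product_measure1E//=; try exact: mc.
    by rewrite !Pcyl//; (exact: tr0 || exact: tr1).
  exact: h.
Qed.
End existence.

End WalkPairExistence.

Section bound.
Context {R : realType}.

Definition edge_prob (c beta : R) (n : nat) : R :=
  Num.min (c * n%:R `^ (beta - 1)) 1.

Definition mean_degree (c beta : R) (n : nat) : R := n%:R * edge_prob c beta n.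

Definition deviation_bound (c beta nu1 nu2 theta : R) (n : nat) : R :=
  let d := mean_degree c beta n in
  2 * n%:R * expR (- (nu1 ^+ 2 * d / 3))
  + 2 * 'C(n, 2)%:R * expR (- (nu2 ^+ 2 * d ^+ 2 / (3 * n%:R)))
  + expR (- (theta * ln n%:R ^+ 2)).

End bound.

(* Main.v *)
Require Import Defs.
From mathcomp Require Import all_boot all_order all_algebra.
From mathcomp Require Import all_classical all_reals all_analysis.
From mathcomp Require Import ring lra zify.
Import Order.TTheory GRing.Theory Num.Theory.
Import numFieldNormedType.Exports.
Local Open Scope classical_set_scope.
Local Open Scope ring_scope.

Set Implicit Arguments.
Unset Strict Implicit.
Unset Printing Implicit Defensive.

(** Why the theorem holds.

    With high probability every degree of the graph is (1 +- delta) d and every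
    pair of distinct vertices has at least (1 - delta) d^2 / n common
    neighbours.  On such a balanced graph two steps of the walk already forget
    the starting point: P^2(i, j) is about codeg(i, j) / d^2, hence at least
    kappa pi_j with kappa = 1 - 5 delta close to 1 ([balanced_doeblin]).  This
    uniform minorisation replaces any spectral or mixing-time argument.

    Let h(i, j) be the expected meeting time and t its mean under pi x pi.  Two
    facts about the pair of walks give t.

    - Kac's formula for the diagonal: the pair chain is stationary under
      pi x pi, so the sum over i of pi_i^2 (1 + E h(X_1, Y_1)), where X and Y
      both start at i, equals 1 ([pair_return_mean]).  As pi is nearly uniform,
      the pi_i^2 sum to about 1 / n.

    - Minorisation: after two steps the pair is stationary with probability
      kappa^2 from any starting point.  Hence h <= t + 2 / kappa^2 everywhere
      ([capped_time_le_mean]), and conversely a pair that starts on the diagonal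
      needs at least kappa^2 t on average, up to the chance (at most the
      largest entry of P, about 1 / d) that it meets again at once
      ([pair_mean_upper]).

    Together they give t = n (1 + O(delta)).  The meeting times are truncated at
    a horizon T and the estimates are uniform in T, so that finiteness of t is
    a conclusion and need not be known beforehand.

    For the probability of a balanced graph, degrees and codegrees are sums of
    independent indicators, and Chernoff bounds with a union bound over the n
    vertices and the n (n - 1) ordered pairs give the first two terms of the
    deviation bound ([balanced_prob]).  The hypothesis
    beta > 1/2 makes d^2 / n at least a positive power of n, so every
    exponential beats the number of vertices and pairs
    ([mean_codegree_ge], [deviation_bound_cvg]). *)

(** * Truncated meeting times of a pair of chains *)

Section pair_chain.
Context {R : realFieldType} {I : finType}.
Implicit Types (P : I -> I -> R) (f g : I -> I -> R) (mu : I -> R).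

(** The transition operator of the product chain, acting on observables. *)
Definition pair_step P f (i j : I) : R := \sum_k \sum_l P i k * P j l * f k l.

(** The probability that two independent chains started at i and j have not met
    at any of the times 0, ..., t, by first-step analysis. *)
Fixpoint survival P (t : nat) (i j : I) : R :=
  if i == j then 0 else
  if t is s.+1 then pair_step P (survival P s) i j else 1.

(** The tail-sum formula: this is the mean of min(tau, T) for the meeting time
    tau of chains started at i and j. *)
Definition capped_time P (T : nat) (i j : I) : R :=
  \sum_(t < T) survival P t i j.

Definition pair_mean mu f : R := \sum_i \sum_j mu i * mu j * f i j.

Lemma pair_stepD P f g i j :
  pair_step P (fun k l => f k l + g k l) i j = pair_step P f i j + pair_step P g i j.
Proof.
rewrite /pair_step -big_split; apply: eq_bigr => k _; rewrite -big_split.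
by apply: eq_bigr => l _; rewrite mulrDr.
Qed.

Lemma pair_stepZ P a f i j :
  pair_step P (fun k l => a * f k l) i j = a * pair_step P f i j.
Proof.
rewrite /pair_step mulr_sumr; apply: eq_bigr => k _; rewrite mulr_sumr.
by apply: eq_bigr => l _; ring.
Qed.

Lemma pair_step_sum P (f : nat -> I -> I -> R) T i j :
  pair_step P (fun k l => \sum_(t < T) f t k l) i j =
  \sum_(t < T) pair_step P (f t) i j.
Proof.
rewrite /pair_step [RHS]exchange_big /=; apply: eq_bigr => k _.
rewrite [RHS]exchange_big /=; apply: eq_bigr => l _; exact: mulr_sumr.
Qed.

Lemma pair_meanD mu f g :
  pair_mean mu (fun k l => f k l + g k l) = pair_mean mu f + pair_mean mu g.
Proof.
rewrite /pair_mean -big_split; apply: eq_bigr => k _; rewrite -big_split.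
by apply: eq_bigr => l _; rewrite mulrDr.
Qed.

Lemma pair_mean_sum mu (f : nat -> I -> I -> R) T :
  pair_mean mu (fun k l => \sum_(t < T) f t k l) = \sum_(t < T) pair_mean mu (f t).
Proof.
rewrite /pair_mean [RHS]exchange_big /=; apply: eq_bigr => k _.
rewrite [RHS]exchange_big /=; apply: eq_bigr => l _; exact: mulr_sumr.
Qed.

Lemma pair_mean_cst mu a : \sum_i mu i = 1 -> pair_mean mu (fun _ _ => a) = a.
Proof.
move=> mu1; rewrite /pair_mean; transitivity (\sum_i mu i * a).
  by apply: eq_bigr => i _; rewrite -mulr_suml -mulr_sumr mu1 mulr1.
by rewrite -mulr_suml mu1 mul1r.
Qed.

(** The first-step equation.  Off the diagonal it is the usual one; on the
    diagonal the truncated time is 0, and the right-hand side without the case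
    distinction is instead the mean return time used in Kac's formula. *)
Lemma capped_timeS P T i j :
  capped_time P T.+1 i j =
  if i == j then 0 else 1 + pair_step P (capped_time P T) i j.
Proof.
rewrite /capped_time pair_step_sum; case: eqP => [ij|/eqP ij].
  by apply: big1 => -[[|t] tT] _; rewrite /= ij eqxx.
by rewrite big_ord_recl /= (negbTE ij).
Qed.

Section stochastic.
Context {P : I -> I -> R} {mu : I -> R}.
Hypothesis P_ge0 : forall i j, 0 <= P i j.
Hypothesis P_sum1 : forall i, \sum_j P i j = 1.
Hypothesis mu_ge0 : forall i, 0 <= mu i.
Hypothesis mu_sum1 : \sum_i mu i = 1.
Hypothesis mu_stat : forall j, \sum_i mu i * P i j = mu j.

Lemma le_pair_step f g i j : (forall k l, f k l <= g k l) ->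
  pair_step P f i j <= pair_step P g i j.
Proof.
move=> fg; apply: ler_sum => k _; apply: ler_sum => l _.
by rewrite ler_wpM2l ?mulr_ge0.
Qed.

Lemma pair_step_cst a i j : pair_step P (fun _ _ => a) i j = a.
Proof.
rewrite /pair_step; transitivity (\sum_k P i k * a).
  by apply: eq_bigr => k _; rewrite -mulr_suml -mulr_sumr P_sum1 mulr1.
by rewrite -mulr_suml P_sum1 mul1r.
Qed.

Lemma pair_mean_step f : pair_mean mu (pair_step P f) = pair_mean mu f.
Proof.
rewrite /pair_mean /pair_step.
transitivity (\sum_i \sum_j \sum_k \sum_l
    (mu i * P i k) * (mu j * P j l) * f k l).
  apply: eq_bigr => i _; apply: eq_bigr => j _.
  rewrite mulr_sumr; apply: eq_bigr => k _.
  by rewrite mulr_sumr; apply: eq_bigr => l _; ring.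
under eq_bigr do rewrite exchange_big /=.
rewrite exchange_big /=; apply: eq_bigr => k _.
under eq_bigr do rewrite exchange_big /=.
rewrite exchange_big /=; apply: eq_bigr => l _.
rewrite -(mu_stat k) -(mu_stat l) mulr_suml mulr_suml; apply: eq_bigr => i _.
by rewrite mulr_sumr mulr_suml.
Qed.

Lemma pair_step2E f i j : pair_step P (pair_step P f) i j =
  \sum_k \sum_l (\sum_h P i h * P h k) * (\sum_h P j h * P h l) * f k l.
Proof.
rewrite /pair_step.
transitivity (\sum_h \sum_h' \sum_k \sum_l
    (P i h * P h k) * (P j h' * P h' l) * f k l).
  apply: eq_bigr => h _; apply: eq_bigr => h' _.
  rewrite mulr_sumr; apply: eq_bigr => k _.
  by rewrite mulr_sumr; apply: eq_bigr => l _; ring.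
under eq_bigr do rewrite exchange_big /=.
rewrite exchange_big /=; apply: eq_bigr => k _.
under eq_bigr do rewrite exchange_big /=.
rewrite exchange_big /=; apply: eq_bigr => l _.
rewrite mulr_suml mulr_suml; apply: eq_bigr => h _.
by rewrite mulr_sumr mulr_suml.
Qed.

Lemma survival_ge0 t i j : 0 <= survival P t i j.
Proof.
elim: t i j => [|t IH] i j /=; case: ifP => // _.
by apply: sumr_ge0 => k _; apply: sumr_ge0 => l _; rewrite !mulr_ge0.
Qed.

Lemma capped_time_ge0 T i j : 0 <= capped_time P T i j.
Proof. by apply: sumr_ge0 => t _; exact: survival_ge0. Qed.

Lemma capped_time_le T i j : capped_time P T i j <= capped_time P T.+1 i j.
Proof. by rewrite /capped_time big_ord_recr lerDl survival_ge0. Qed.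

Lemma capped_time_leS T i j :
  capped_time P T.+1 i j <= 1 + pair_step P (capped_time P T) i j.
Proof.
rewrite capped_timeS; case: eqP => // _; rewrite addr_ge0//.
by apply: sumr_ge0 => k _; apply: sumr_ge0 => l _;
  rewrite !mulr_ge0 // capped_time_ge0.
Qed.

Lemma pair_mean_ge0 f : (forall i j, 0 <= f i j) -> 0 <= pair_mean mu f.
Proof.
by move=> f0; apply: sumr_ge0 => k _; apply: sumr_ge0 => l _; rewrite !mulr_ge0.
Qed.

(** Kac's formula for the diagonal, truncated at T.  One averaging step preserves
    the stationary mean, and 1 + pair_step h_T agrees with h_(T + 1) off the
    diagonal; subtracting the means leaves the return times to the diagonal,
    weighted by its stationary mass. *)
Lemma pair_return_mean T :
  \sum_i mu i ^+ 2 * (1 + pair_step P (capped_time P T) i i) =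
  1 + pair_mean mu (capped_time P T) - pair_mean mu (capped_time P T.+1).
Proof.
rewrite -[X in 1 + X]pair_mean_step -[X in X + _ - _](pair_mean_cst 1 mu_sum1).
rewrite -pair_meanD /pair_mean -sumrB; apply: eq_bigr => i _.
rewrite -sumrB (bigD1 i)//= capped_timeS eqxx mulr0 subr0 big1 ?addr0//.
by move=> j ji; rewrite capped_timeS eq_sym (negbTE ji) subrr.
Qed.

Section doeblin.
Context {kappa : R}.
Hypothesis kappa_gt0 : 0 < kappa.
Hypothesis doeblin : forall i j, kappa * mu j <= \sum_k P i k * P k j.

(** After two steps each coordinate of the pair carries a kappa-fraction of the
    stationary law, and the two coordinates are independent. *)
Lemma doeblin_ge f i j : (forall k l, 0 <= f k l) ->
  kappa ^+ 2 * pair_mean mu f <= pair_step P (pair_step P f) i j.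
Proof.
move=> f0; rewrite pair_step2E /pair_mean mulr_sumr; apply: ler_sum => k _.
rewrite mulr_sumr; apply: ler_sum => l _.
have -> : kappa ^+ 2 * (mu k * mu l * f k l) =
  (kappa * mu k) * (kappa * mu l) * f k l by ring.
have k0 := ltW kappa_gt0.
by apply: ler_wpM2r => //; apply: ler_pM => //; rewrite mulr_ge0.
Qed.

(** The previous bound applied to M - f. *)
Lemma doeblin_le f M i j : (forall k l, f k l <= M) ->
  pair_step P (pair_step P f) i j <=
  kappa ^+ 2 * pair_mean mu f + (1 - kappa ^+ 2) * M.
Proof.
move=> fM.
have := @doeblin_ge (fun k l => M + (-1) * f k l) i j.
have -> : pair_step P (pair_step P (fun k l => M + -1 * f k l)) i j
    = M - pair_step P (pair_step P f) i j.
  transitivity (pair_step P (fun k l => M + -1 * pair_step P f k l) i j).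
    apply: eq_bigr => k _; apply: eq_bigr => l _.
    by rewrite pair_stepD pair_stepZ pair_step_cst.
  by rewrite pair_stepD pair_stepZ pair_step_cst mulN1r.
have -> : pair_mean mu (fun k l => M + -1 * f k l) = M - pair_mean mu f.
  rewrite pair_meanD pair_mean_cst//; congr (_ + _).
  rewrite /pair_mean -sumrN; apply: eq_bigr => k _.
  by rewrite -sumrN; apply: eq_bigr => l _; ring.
have H k l : 0 <= M + -1 * f k l by move: (fM k l); lra.
by move=> /(_ H); lra.
Qed.

(** At a pair (a, b) maximising the truncated time, two steps cost 2 and then
    restart the pair from stationarity with probability kappa^2, otherwise from
    a position no worse than (a, b); solving for the maximum gives the bound.
    The error is additive and does not grow with T. *)
Lemma capped_time_le_mean T i j :
  capped_time P T i j <= pair_mean mu (capped_time P T) + 2 / kappa ^+ 2.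
Proof.
pose F (x : I * I) := capped_time P T x.1 x.2.
have [[a b] _ /= maxF] := @arg_maxP _ R _ (i, j) xpredT F isT.
have {}maxF k l : capped_time P T k l <= capped_time P T a b.
  exact: (maxF (k, l) isT).
apply: (le_trans (maxF i j)).
have k2 : 0 < kappa ^+ 2 by rewrite exprn_gt0.
have : capped_time P T a b <= 2 + (kappa ^+ 2 * pair_mean mu (capped_time P T)
    + (1 - kappa ^+ 2) * capped_time P T a b).
  apply: (le_trans (le_trans (capped_time_le T a b) (capped_time_le T.+1 a b))).
  apply: (le_trans (capped_time_leS _ _ _)).
  have -> : (2 : R) = 1 + 1 by []. rewrite -addrA lerD2l.
  apply: (le_trans _ (lerD (lexx _) (doeblin_le a b maxF))).
  rewrite -[X in X + _](pair_step_cst 1 a b) -pair_stepD.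
  by apply: le_pair_step => k l; exact: capped_time_leS.
move=> H; rewrite -subr_ge0 -(pmulr_rge0 _ k2).
have -> : kappa ^+ 2 * (pair_mean mu (capped_time P T) + 2 / kappa ^+ 2
   - capped_time P T a b) =
   kappa ^+ 2 * pair_mean mu (capped_time P T) + 2 - kappa ^+ 2 * capped_time P T a b.
  by field; rewrite gt_eqF.
by lra.
Qed.

(** Kac's formula bounds the stationary mean from above once the return time to
    the diagonal is bounded from below.  The return time from (i, i) is at
    least the two-step average of the truncated time, which is at least kappa^2
    times its mean, minus the loss from pairs that meet again at the first
    step; this has probability sum_k P(i, k)^2 <= b. *)
Lemma pair_mean_upper b T : (forall i j, P i j <= b) ->
  (\sum_i mu i ^+ 2) * (1 + kappa ^+ 2 * pair_mean mu (capped_time P T)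
     - b * (pair_mean mu (capped_time P T) + 2 / kappa ^+ 2)) <= 1.
Proof.
move=> Pb; set t := pair_mean _ _; set C := 2 / _.
have : 1 + pair_mean mu (capped_time P T.+1) - pair_mean mu (capped_time P T.+2) <= 1.
  rewrite -addrA gerDl subr_le0.
  apply: ler_sum => k _; apply: ler_sum => l _.
  by rewrite ler_wpM2l ?mulr_ge0// capped_time_le.
rewrite -pair_return_mean; apply: le_trans; rewrite mulr_suml.
apply: ler_sum => i _; apply: ler_wpM2l; first exact: sqr_ge0.
rewrite -addrA lerD2l.
have M0 : 0 <= t + C.
  by apply: (le_trans (capped_time_ge0 T i i) (capped_time_le_mean T i i)).
have H k l : pair_step P (capped_time P T) k l + (- (t + C)) * (k == l)%:R
    <= capped_time P T.+1 k l.
  rewrite capped_timeS; case: eqP => _; last by rewrite mulr0 addr0 lerDr.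
  rewrite mulr1 subr_le0 -[leRHS](pair_step_cst _ k l).
  by apply: le_pair_step => k' l'; exact: capped_time_le_mean.
apply: le_trans (le_pair_step i i H); rewrite pair_stepD pair_stepZ.
apply: lerD; first by apply: doeblin_ge => k l; exact: capped_time_ge0.
rewrite mulNr lerN2 [b * _]mulrC; apply: ler_wpM2l => //.
apply: (@le_trans _ _ (\sum_k b * P i k)); last by rewrite -mulr_sumr P_sum1 mulr1.
apply: ler_sum => k _.
rewrite (bigD1 k)//= eqxx mulr1 big1 ?addr0 ?ler_wpM2r//.
by move=> l; rewrite eq_sym => /negbTE ->; rewrite mulr0.
Qed.

(** The opposite half of Kac's formula: no return time exceeds the stationary
    mean by more than an additive constant.  The left-hand side tends to 1 when
    the truncated means converge. *)
Lemma pair_mean_lower T :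
  1 + pair_mean mu (capped_time P T) - pair_mean mu (capped_time P T.+1) <=
  (\sum_i mu i ^+ 2) * (1 + pair_mean mu (capped_time P T) + 2 / kappa ^+ 2).
Proof.
rewrite -pair_return_mean mulr_suml; apply: ler_sum => i _.
apply: ler_wpM2l; first exact: sqr_ge0.
rewrite -addrA lerD2l -[leRHS](pair_step_cst _ i i).
by apply: le_pair_step => k l; exact: capped_time_le_mean.
Qed.

End doeblin.
End stochastic.
End pair_chain.

(** * The law of two random walks and of their meeting time *)

Lemma measure_fibers {R : realType} d (T : measurableType d)
    (mu : {measure set T -> \bar R}) (V : finType) (Z : T -> V) (S : set T) :
  (forall v, measurable [set w | Z w = v]) -> measurable S ->
  mu S = (\sum_v mu (S `&` [set w | Z w = v]))%E.
Proof.
move=> mZ mS; rewrite bigfs ?index_enum_uniq//; last first.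
  by move=> v _; rewrite mem_index_enum.
rewrite -measure_fin_bigcup//.
- congr (mu _); apply/seteqP; split=> w /=; last by case=> v _ [].
  by move=> Sw; exists (Z w).
- by move=> u v _ _ [w [[_ <-] [_ <-]]].
- by move=> v _; exact: measurableI.
Qed.

Section walk_law.
Context {R : realType} {n : nat} (G : graph n) (i j : 'I_n).
Context {d : measure_display} {T : measurableType d} (mu : probability T R).
Context (X Y : nat -> T -> 'I_n).
Hypothesis X_walk : is_random_walk mu X G i.
Hypothesis Y_walk : is_random_walk mu Y G j.
Hypothesis XY_indep : independent_processes mu X Y.

Let tr := @transition R n G.

Definition apart t : set T := [set w | forall s, (s <= t)%N -> X s w <> Y s w].

Definition apart_at t k l : set T :=
  apart t `&` [set w | (X t w, Y t w) = (k, l)].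

Let measurableX t v : measurable [set w | X t w = v].
Proof. by case: X_walk. Qed.

Let measurableY t v : measurable [set w | Y t w = v].
Proof. by case: Y_walk. Qed.

Lemma measurable_pair t (v : 'I_n * 'I_n) : measurable [set w | (X t w, Y t w) = v].
Proof.
rewrite (_ : mkset _ = [set w | X t w = v.1] `&` [set w | Y t w = v.2]).
  exact: measurableI.
by apply/seteqP; split=> w /=; case: v => a b /= [-> ->].
Qed.

Lemma measurable_apart t : measurable (apart t).
Proof.
rewrite (_ : apart t = \bigcap_(s < t.+1) ~` \bigcup_v [set w | (X s w, Y s w) = (v, v)]).
  apply: bigcap_measurableType => s _; apply: measurableC.
  by apply: fin_bigcup_measurable => // v _; exact: measurable_pair.
apply/seteqP; split=> w /=.
  by move=> h s; rewrite /= ltnS => st [v _] /= [Xv Yv]; apply: (h s st); rewrite Xv.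
move=> h s st e; apply: (h s); rewrite /= ?ltnS//; exists (X s w) => //=.
by rewrite -e.
Qed.

Lemma measurable_apart_at t k l : measurable (apart_at t k l).
Proof. by apply: measurableI; [exact: measurable_apart|exact: measurable_pair]. Qed.

Let cylE (Z : nat -> T -> 'I_n) t x :
  cylinder Z t.+1 x = cylinder Z t x `&` [set w | Z t.+1 w = x t.+1].
Proof.
apply/seteqP; split=> w /=.
  by move=> h; split=> [s st|]; apply: h => //; exact: leqW.
by move=> [h1 h2] s; rewrite leq_eqVlt => /predU1P[->//|]; rewrite ltnS; exact: h1.
Qed.

Let eq_cyl (Z : nat -> T -> 'I_n) t x y : (forall s, (s <= t)%N -> x s = y s) ->
  cylinder Z t x = cylinder Z t y.
Proof.
by move=> xy; apply/seteqP; split=> w h s st; rewrite h// xy.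
Qed.

Let measurable_cyl (Z : nat -> T -> 'I_n) t x :
  (forall s v, measurable [set w | Z s w = v]) -> measurable (cylinder Z t x).
Proof.
move=> mZ; elim: t => [|t IH]; last by rewrite cylE; exact: measurableI.
rewrite (_ : cylinder Z 0 x = [set w | Z 0%N w = x 0%N])//.
apply/seteqP; split=> w /=; first by apply.
by move=> h s; rewrite leqn0 => /eqP ->.
Qed.

(** The one-step Markov property of the pair, on path events: independence is
    known only for cylinders of equal length, so both paths are extended by one
    step before it is applied. *)
Lemma joint_step t x y k l :
  mu (cylinder X t x `&` cylinder Y t y `&` [set w | (X t.+1 w, Y t.+1 w) = (k, l)])
  = (mu (cylinder X t x `&` cylinder Y t y) * (tr (x t) k * tr (y t) l)%:E)%E.
Proof.
pose ext (z : nat -> 'I_n) v s := if (s <= t)%N then z s else v.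
have extE z v s : (s <= t)%N -> ext z v s = z s by rewrite /ext => ->.
have extS z v : ext z v t.+1 = v by rewrite /ext ltnn.
have -> : cylinder X t x `&` cylinder Y t y `&`
    [set w | (X t.+1 w, Y t.+1 w) = (k, l)] =
    cylinder X t.+1 (ext x k) `&` cylinder Y t.+1 (ext y l).
  rewrite !cylE !extS (eq_cyl _ (extE x k)) (eq_cyl _ (extE y l)).
  by apply/seteqP; split=> w /=; [move=> [[? ?] [? ?]]|move=> [[? ->] [? ->]]].
rewrite !XY_indep; case: X_walk => _ _ ->; case: Y_walk => _ _ ->.
rewrite !extS !extE// (eq_cyl _ (extE x k)) (eq_cyl _ (extE y l)).
by rewrite muleACA EFinM.
Qed.

(** The Markov property of the pair on the event of not having met, obtained by
    cutting this event into the finitely many path events that it contains. *)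
Lemma apart_at_step t k l k' l' :
  mu (apart_at t k l `&` [set w | (X t.+1 w, Y t.+1 w) = (k', l')]) =
  (mu (apart_at t k l) * (tr k k' * tr l l')%:E)%E.
Proof.
pose path := {ffun 'I_t.+1 -> 'I_n}.
pose ext (x : path) (s : nat) := x (inord s).
pose Z w : path * path := ([ffun s : 'I_t.+1 => X s w], [ffun s : 'I_t.+1 => Y s w]).
have ZE v : [set w | Z w = v] = cylinder X t (ext v.1) `&` cylinder Y t (ext v.2).
  apply/seteqP; split=> w /=.
    by move=> <-; split=> s st; rewrite /ext ffunE inordK.
  case: v => x y [/= hx hy]; congr (_, _); apply/ffunP => s; rewrite ffunE.
    by rewrite hx ?leq_ord// /ext inord_val.
  by rewrite hy ?leq_ord// /ext inord_val.
have mZ v : measurable [set w | Z w = v].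
  by rewrite ZE; apply: measurableI; exact: measurable_cyl.
have mA := measurable_apart_at t k l.
rewrite (measure_fibers mu mZ); last by apply: measurableI => //; exact: measurable_pair.
rewrite [in RHS](measure_fibers mu mZ)// ge0_sume_distrl; last by move=> *; exact: measure_ge0.
apply: eq_bigr => v _.
have [sub|dis] := pselect ([set w | Z w = v] `<=` apart_at t k l); last first.
  have e0 : apart_at t k l `&` [set w | Z w = v] = set0.
    rewrite -subset0 => w [wA wv]; apply: dis => w' w'v.
    have [eX eY] : (forall s, (s <= t)%N -> X s w = X s w') /\
        (forall s, (s <= t)%N -> Y s w = Y s w').
      have : Z w = Z w' by rewrite wv w'v.
      move=> [/ffunP eX /ffunP eY]; split=> s st.
        by have := eX (inord s); rewrite !ffunE inordK.
      by have := eY (inord s); rewrite !ffunE inordK.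
    case: wA => h e; split; last by rewrite /= -eX// -eY.
    by move=> s st; rewrite -eX// -eY//; exact: h.
  by rewrite setIAC e0 set0I !measure0 mul0e.
rewrite setIAC (setIidr sub).
have [->|/set0P[w wv]] := eqVneq [set w | Z w = v] set0.
  by rewrite set0I !measure0 mul0e.
have [_ [<- <-]] := sub _ wv.
have : cylinder X t (ext v.1) w /\ cylinder Y t (ext v.2) w by rewrite ZE in wv.
move=> [-> // -> //].
by rewrite ZE; exact: joint_step.
Qed.

Definition apart_prob t k l : R := fine (mu (apart_at t k l)).

Lemma apart_probE t k l : mu (apart_at t k l) = (apart_prob t k l)%:E.
Proof. by rewrite fineK// fin_num_measure//; exact: measurable_apart_at. Qed.

Lemma apart_prob_diag t k : apart_prob t k k = 0.
Proof.
rewrite /apart_prob (_ : apart_at t k k = set0) ?measure0// -subset0 => w.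
by move=> [h /= [Xk Yk]]; apply: (h t) => //; rewrite Xk.
Qed.

Lemma apart_probS t k l : apart_prob t.+1 k l =
  if k == l then 0 else \sum_a \sum_b apart_prob t a b * tr a k * tr b l.
Proof.
case: eqP => [<-|kl]; first exact: apart_prob_diag.
apply: EFin_inj; rewrite -apart_probE.
have -> : apart_at t.+1 k l = apart t `&` [set w | (X t.+1 w, Y t.+1 w) = (k, l)].
  apply/seteqP; split=> w [h e]; split=> // s st; first by apply: h; exact: leqW.
  move: st; rewrite leq_eqVlt ltnS => /predU1P[->|]; last exact: h.
  by case: e => -> ->.
rewrite (measure_fibers mu (measurable_pair t)); last first.
  by apply: measurableI; [exact: measurable_apart|exact: measurable_pair].
rewrite pair_big_dep /= -sumEFin; apply: eq_bigr => -[a b] _.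
by rewrite setIAC apart_at_step apart_probE -EFinM mulrA.
Qed.

Lemma initial_law (Z : nat -> T -> 'I_n) z (v : 'I_n) : is_random_walk mu Z G z ->
  mu [set w | Z 0%N w = v] = (v == z)%:R%:E.
Proof.
case=> mZ Z0 _; case: eqP => [->|vz]; first exact: Z0.
apply/eqP; rewrite eq_le measure_ge0 andbT.
have U : mu ([set w | Z 0%N w = v] `|` [set w | Z 0%N w = z]) =
    (mu [set w | Z 0%N w = v] + mu [set w | Z 0%N w = z])%E.
  apply: measureU => //; rewrite -subset0 => w [/= wv wz].
  by apply: vz; rewrite -wv -wz.
have : (mu ([set w | Z 0%N w = v] `|` [set w | Z 0%N w = z]) <= 1)%E.
  by apply: probability_le1; apply: measurableU.
by rewrite U Z0 -[X in (_ <= X)%E]add0e leeD2rE.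
Qed.

Lemma apart_prob0 k l : apart_prob 0 k l = if i == j then 0 else (k == i)%:R * (l == j)%:R.
Proof.
have [<-|kl] := eqVneq k l.
  rewrite apart_prob_diag; case: eqP => // ij; case: eqP => [->|_]; last by rewrite mul0r.
  by case: eqP => // _; rewrite mulr0.
have -> : (if i == j then 0 else (k == i)%:R * (l == j)%:R) = (k == i)%:R * (l == j)%:R :> R.
  case: eqP => // ij; case: eqP => [ki|_]; last by rewrite mul0r.
  case: eqP => [lj|]; last by rewrite mulr0.
  by move: kl; rewrite ki lj ij eqxx.
apply: EFin_inj; rewrite -apart_probE.
have cyl0 (Z : nat -> T -> 'I_n) v :
    cylinder Z 0 (fun=> v) = [set w | Z 0%N w = v].
  apply/seteqP; split=> w /=; first by apply.
  by move=> h s; rewrite leqn0 => /eqP ->.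
have -> : apart_at 0 k l = cylinder X 0 (fun=> k) `&` cylinder Y 0 (fun=> l).
  rewrite !cyl0; apply/seteqP; split=> w /=; first by move=> [_ /= [-> ->]].
  move=> [Xk Yl]; split=> /=; last by rewrite Xk Yl.
  by move=> s; rewrite leqn0 => /eqP ->; rewrite Xk Yl; exact/eqP.
by rewrite XY_indep !cyl0 (initial_law _ X_walk) (initial_law _ Y_walk) EFinM.
Qed.

(** The walk law evolves forward in time and [survival] backward; moving one time
    step from one to the other leaves the pairing unchanged, because both vanish
    on the diagonal. *)
Lemma apart_prob_survival t s :
  \sum_k \sum_l apart_prob t k l * survival tr s k l = survival tr (s + t) i j.
Proof.
elim: t s => [|t IH] s.
  rewrite addn0 (bigD1 i)//= (bigD1 j)//= !big1 ?addr0; first last.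
  - by move=> l lj; rewrite apart_prob0 (negbTE lj) mulr0 if_same mul0r.
  - move=> k ki; apply: big1 => l _.
    by rewrite apart_prob0 (negbTE ki) mul0r if_same mul0r.
  rewrite apart_prob0 !eqxx mulr1; case: eqP => [->|_]; last by rewrite mul1r.
  by rewrite mul0r; case: s => [|s] /=; rewrite eqxx.
rewrite addnS -addSn -IH.
transitivity (\sum_k \sum_l \sum_a \sum_b
    apart_prob t a b * tr a k * tr b l * survival tr s k l).
  apply: eq_bigr => k _; apply: eq_bigr => l _; rewrite apart_probS.
  case: eqP => [->|_].
    by rewrite mul0r; symmetry; apply: big1 => a _; apply: big1 => b _;
      case: s => [|s] /=; rewrite eqxx mulr0.
  by rewrite mulr_suml; apply: eq_bigr => a _; rewrite mulr_suml.
under eq_bigr do rewrite exchange_big /=.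
rewrite exchange_big /=; apply: eq_bigr => a _.
under eq_bigr do rewrite exchange_big /=.
rewrite exchange_big /=; apply: eq_bigr => b _.
rewrite (fun_if (fun z => apart_prob t a b * z)) mulr0.
case: eqP => [->|_].
  by apply: big1 => k _; apply: big1 => l _; rewrite apart_prob_diag !mul0r.
rewrite /pair_step mulr_sumr; apply: eq_bigr => k _.
by rewrite mulr_sumr; apply: eq_bigr => l _; rewrite !mulrA.
Qed.

Lemma apart_measure t : mu (apart t) = (survival tr t i j)%:E.
Proof.
rewrite (measure_fibers mu (measurable_pair t) (measurable_apart t)).
rewrite -[t in RHS]add0n -apart_prob_survival pair_big_dep /= -sumEFin.
apply: eq_bigr => -[a b] _; rewrite -/(apart_at t a b) apart_probE /=.
by case: eqP => [->|_]; rewrite ?apart_prob_diag ?mul0r ?mulr1.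
Qed.

(** The tail-sum formula pointwise; both sides are infinite when the paths never
    meet. *)
Lemma meeting_time_series w :
  ereal_inf [set t%:R%:E | t in [set t | X t w = Y t w]] =
  (\sum_(0 <= t <oo) (\1_(apart t) w : R)%:E)%E.
Proof.
have [[t0 ht0]|never] := pselect (exists t, X t w = Y t w); last first.
  have -> : [set t | X t w = Y t w] = set0.
    by rewrite -subset0 => t /= h; apply: never; exists t.
  rewrite image_set0 ereal_inf0; symmetry; apply: eq_infty => r.
  have [m rm] : exists m : nat, r <= m%:R.
    by exists (Num.trunc r).+1; exact/ltW/Num.Theory.truncnS_gt.
  apply: le_trans (nneseries_lim_ge m _); last first.
    by move=> t _ _; rewrite lee_fin indicE; case: (_ \in _).
  rewrite (eq_bigr (fun=> 1%E)); last first.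
    move=> t _; rewrite indicE mem_set// => s _ h.
    by apply: never; exists s.
  by rewrite big_mkord sumEFin lee_fin sumr_const card_ord.
have ex : exists t, X t w == Y t w by exists t0; exact/eqP.
case: (ex_minnP ex) => m /eqP Xm minm.
have apartE t : (w \in apart t) = (t < m)%N.
  apply/idP/idP => [/set_mem h|tm].
    by rewrite ltnNge; apply/negP => mt; exact: (h m).
  rewrite mem_set// => s st /eqP /minm; rewrite leqNgt => /negP; apply.
  exact: leq_ltn_trans tm.
transitivity (m%:R%:E : \bar R).
  apply/eqP; rewrite eq_le; apply/andP; split.
    by apply: ereal_inf_lbound; exists m.
  apply: le_ereal_inf_tmp; rewrite /lbound /= => _ [t /= /eqP /minm mt <-].
  by rewrite lee_fin ler_nat.
rewrite (nneseries_split _ m); last by move=> t _; rewrite lee_fin indicE; case: (_ \in _).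
rewrite add0n [X in (_ + X)%E]eseries0 ?adde0; last first.
  by move=> t mt _; rewrite indicE apartE ltnNge mt.
rewrite big_mkord (eq_bigr (fun=> 1%E)); last by move=> t _; rewrite indicE apartE ltn_ord.
by rewrite sumEFin sumr_const card_ord.
Qed.

Lemma meeting_time_mean :
  (\int[mu]_w ereal_inf [set t%:R%:E | t in [set t | X t w = Y t w]] =
   \sum_(0 <= t <oo) (survival tr t i j)%:E)%E.
Proof.
under eq_integral do rewrite meeting_time_series.
rewrite integral_nneseries//.
- apply: eq_eseriesr => t _.
  rewrite integral_indic//; last exact: measurable_apart.
  by rewrite setIT; exact: apart_measure.
- by move=> t; apply/measurable_realfun.measurable_EFinP; apply: measurable_realfun.measurable_indic; exact: measurable_apart.
Qed.

End walk_law.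

Lemma expected_meeting_timeE {R : realType} {n : nat} (G : graph n) (i j : 'I_n)
    (W : walk_pair R G i j) :
  expected_meeting_time W =
  (\sum_(0 <= t <oo) (survival (transition G) t i j)%:E)%E.
Proof. by apply: meeting_time_mean; [exact: wp_X_walk|exact: wp_Y_walk|exact: wp_indep]. Qed.

(** * Random walk on a balanced graph *)

Section graph_chain.
Context {R : realType} {n : nat} (G : graph n).

Lemma adjC i j : adj G i j = adj G j i.
Proof. by have /andP[/eqP AT _] := valP G; rewrite -[in LHS]AT mxE. Qed.

Lemma adj_irrefl i : adj G i i = false.
Proof. by have /andP[_ /forallP/(_ i)/negbTE] := valP G. Qed.

Lemma stationary_ge0 i : 0 <= stationary G i :> R.
Proof. exact: divr_ge0. Qed.

Lemma stationary_sum1 : (0 < \sum_k deg G k)%N -> \sum_i stationary G i = 1 :> R.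
Proof.
by move=> D0; rewrite /stationary -mulr_suml -natr_sum divff// pnatr_eq0 -lt0n.
Qed.

Lemma stationary_transition j :
  \sum_i stationary G i * transition G i j = stationary G j :> R.
Proof.
rewrite {2}/stationary /deg natr_sum mulr_suml; apply: eq_bigr => i _.
rewrite /stationary /transition; case: eqP => [d0|/eqP d0]; last first.
  by rewrite mulrC mulrA divfK ?pnatr_eq0// adjC.
rewrite d0 !mul0r; move/eqP: d0; rewrite sum_nat_eq0 => /forallP/(_ j)/=.
by rewrite adjC eqb0 => /negbTE ->; rewrite mul0r.
Qed.

Lemma stationary_meeting_timeE (W : forall i j, walk_pair R G i j) :
  stationary_meeting_time W =
  (\sum_(0 <= t <oo) (pair_mean (stationary G) (survival (transition G) t))%:E)%E.
Proof.
have u0 t i j : (0 <= (survival (transition G) t i j : R)%:E)%E.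
  by rewrite lee_fin survival_ge0// => *; exact: WalkPairExistence.tr0.
rewrite /stationary_meeting_time.
transitivity (\sum_(i < n) \sum_(j < n) \sum_(0 <= t <oo)
  (stationary G i * stationary G j : R)%:E * (survival (transition G) t i j)%:E)%E.
  apply: eq_bigr => i _; apply: eq_bigr => j _.
  by rewrite expected_meeting_timeE nneseriesZl.
have w0 t i j : (0 <= (stationary G i * stationary G j : R)%:E *
    (survival (transition G) t i j)%:E)%E.
  by rewrite mule_ge0// lee_fin mulr_ge0 ?stationary_ge0.
under eq_bigr do rewrite -nneseries_sum//.
rewrite -nneseries_sum; last by move=> i t _; exact: sume_ge0.
apply: eq_eseriesr => t _; rewrite /pair_mean -sumEFin; apply: eq_bigr => i _.
by rewrite -sumEFin; apply: eq_bigr => j _; rewrite -EFinM.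
Qed.

(** Bounds that are uniform in the truncation pass to the limit: the truncated
    means increase to the stationary meeting time, which is therefore finite,
    and the increments in the lower bound vanish. *)
Lemma stationary_meeting_time_lim (W : forall i j, walk_pair R G i j) (U a b : R) :
  (forall T, pair_mean (stationary G) (capped_time (transition G) T) <= U) ->
  (forall T, 1 + pair_mean (stationary G) (capped_time (transition G) T)
     - pair_mean (stationary G) (capped_time (transition G) T.+1)
     <= a * (pair_mean (stationary G) (capped_time (transition G) T) + b)) ->
  exists t : R, [/\ stationary_meeting_time W = t%:E, t <= U & 1 <= a * (t + b)].
Proof.
pose m T : R := pair_mean (stationary G) (capped_time (transition G) T).
rewrite -/m => mU mlow.
have mE T : m T = \sum_(t < T) pair_mean (stationary G) (survival (transition G) t).
  exact: pair_mean_sum.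
have m_nd : nondecreasing_seq m.
  apply/nondecreasing_seqP => T; rewrite !mE big_ord_recr lerDl.
  apply: pair_mean_ge0 => [i|i j]; first exact: stationary_ge0.
  by apply: survival_ge0 => *; exact: WalkPairExistence.tr0.
have m_cvg : m @ \oo --> sup (range m).
  apply: nondecreasing_cvgn => //; exists U => _ [T _ <-]; exact: mU.
exists (sup (range m)); split.
- rewrite stationary_meeting_timeE; apply/cvg_lim => //.
  have -> : (fun T => \sum_(0 <= t < T)
     (pair_mean (stationary G) (survival (transition G) t))%:E)%E = EFin \o m.
    by apply/funext => T; rewrite /= mE big_mkord sumEFin.
  exact: (cvg_comp _ _ m_cvg).
- by rewrite -(cvg_lim _ m_cvg)//; apply: limr_le; [exact: cvgP m_cvg|apply: nearW].
- have mS_cvg : (fun T => m T.+1) @ \oo --> sup (range m) by rewrite (cvg_shiftS m).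
  have lc : (fun T => 1 + m T - m T.+1) @ \oo --> (1 + sup (range m) - sup (range m)).
    by apply: cvgB mS_cvg; apply: cvgD m_cvg; exact: cvg_cst.
  have rc : (fun T => a * (m T + b)) @ \oo --> a * (sup (range m) + b).
    by apply: cvgM; [exact: cvg_cst|apply: cvgD m_cvg _; exact: cvg_cst].
  rewrite -[X in X <= _](addrK (sup (range m))).
  rewrite -(cvg_lim _ lc)// -(cvg_lim _ rc)//.
  apply: ler_lim; [exact: cvgP lc|exact: cvgP rc|exact: nearW].
Qed.

Definition codeg i j : nat := (\sum_(k < n) (adj G i k && adj G j k))%N.

Context (d delta : R).

(** Codegrees are bounded from below only, because they enter through the
    minorisation of P^2. *)
Definition balanced : Prop :=
  [/\ forall i, (1 - delta) * d <= (deg G i)%:R <= (1 + delta) * d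
    & forall i j, i != j -> (1 - delta) * (d ^+ 2 / n%:R) <= (codeg i j)%:R].

Hypothesis delta_gt0 : 0 < delta.
Hypothesis delta_le : 100 * delta <= 1.
Hypothesis d_ge : 2 <= delta * d.
Hypothesis d_le : d <= n%:R.
Hypothesis G_balanced : balanced.

Let d_gt0 : 0 < d. Proof. by rewrite -(pmulr_rgt0 _ delta_gt0); exact: lt_le_trans d_ge. Qed.
Let n_gt0 : 0 < n%:R :> R. Proof. exact: lt_le_trans d_le. Qed.
Let low1 : 0 < 1 - delta. Proof. by have := delta_le; lra. Qed.
Let high1 : 0 < 1 + delta. Proof. by have := delta_gt0; lra. Qed.
Let deg_ge i : (1 - delta) * d <= (deg G i)%:R.
Proof. by case: G_balanced => /(_ i)/andP[]. Qed.
Let deg_le i : (deg G i)%:R <= (1 + delta) * d.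
Proof. by case: G_balanced => /(_ i)/andP[]. Qed.
Let low_gt0 : 0 < (1 - delta) * d. Proof. by apply: mulr_gt0. Qed.
Let high_gt0 : 0 < (1 + delta) * d. Proof. by apply: mulr_gt0. Qed.
Let deg_gt0 i : 0 < (deg G i)%:R :> R. Proof. exact: lt_le_trans (deg_ge i). Qed.

Let transitionE i j : transition G i j = (adj G i j)%:R / (deg G i)%:R :> R.
Proof. by rewrite /transition; case: eqP (deg_gt0 i) => // ->; rewrite ltxx. Qed.

Lemma total_degree_ge : n%:R * ((1 - delta) * d) <= (\sum_k deg G k)%N%:R.
Proof.
rewrite natr_sum -[n in leLHS]card_ord -sumr_const mulr_suml.
by apply: ler_sum => i _; rewrite mul1r.
Qed.

Lemma balanced_stationary_le i :
  stationary G i <= (1 + delta) / ((1 - delta) * n%:R).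
Proof.
have L0 := mulr_gt0 n_gt0 low_gt0.
have D0 := lt_le_trans L0 total_degree_ge.
apply: (@le_trans _ _ ((1 + delta) * d * (n%:R * ((1 - delta) * d))^-1)).
  by apply: ler_pM => //; rewrite ?invr_ge0// lef_pV2// total_degree_ge.
by rewrite le_eqVlt; apply/orP; left; apply/eqP; field; rewrite !gt_eqF.
Qed.

(** For i != j, P^2(i, j) sums 1 / (deg i * deg k) over the common neighbours k;
    for i = j, all neighbours contribute and P^2(i, i) is about 1 / d, at least
    of order 1 / n.  The constant 1 - 5 delta is a lower bound for
    (1 - delta)^2 / (1 + delta)^3. *)
Lemma balanced_doeblin i j : (1 - 5 * delta) * stationary G j <=
  \sum_k transition G i k * transition G k j.
Proof.
have nV : 0 < n%:R^-1 :> R by rewrite invr_gt0.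
have two_step : (1 - delta) / (1 + delta) ^+ 2 / n%:R <=
    \sum_k transition G i k * transition G k j.
  have [<-|ij] := eqVneq i j.
    apply: (@le_trans _ _ (\sum_k transition G i k * ((1 + delta) * d)^-1)).
      rewrite -mulr_suml WalkPairExistence.tr1 mul1r.
      apply: (@le_trans _ _ ((1 + delta) * n%:R)^-1); last first.
        by rewrite lef_pV2 ?posrE ?mulr_gt0// ler_pM2l.
      have -> : ((1 + delta) * n%:R)^-1 = (1 + delta) / (1 + delta) ^+ 2 / n%:R.
        by field; rewrite !gt_eqF.
      rewrite !ler_wpM2r ?invr_ge0 ?exprn_ge0 ?ltW//.
      by have := delta_gt0; lra.
    apply: ler_sum => k _; rewrite !transitionE [adj G k i]adjC.
    case: (adj G i k); last by rewrite !mul0r.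
    by rewrite !mul1r ler_wpM2l ?invr_ge0// lef_pV2 ?posrE.
  apply: (@le_trans _ _ ((codeg i j)%:R / ((1 + delta) * d) ^+ 2)).
    have -> : (1 - delta) / (1 + delta) ^+ 2 / n%:R =
        (1 - delta) * (d ^+ 2 / n%:R) / ((1 + delta) * d) ^+ 2.
      by field; rewrite !gt_eqF.
    apply: ler_wpM2r; first by rewrite invr_ge0 exprn_ge0// ltW.
    by case: G_balanced => _; apply.
  rewrite natr_sum mulr_suml; apply: ler_sum => k _.
  rewrite !transitionE [adj G k j]adjC.
  case: (adj G i k); case: (adj G j k); rewrite ?mul0r ?mulr0// !mul1r.
  have hV : 0 <= ((1 + delta) * d)^-1 by rewrite invr_ge0 ltW.
  by rewrite expr2 invfM; apply: ler_pM => //; rewrite lef_pV2 ?posrE.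
apply: le_trans two_step.
have k0 : 0 <= 1 - 5 * delta by have := delta_le; lra.
apply: (le_trans (ler_wpM2l k0 (balanced_stationary_le j))).
rewrite -subr_ge0.
have -> : (1 - delta) / (1 + delta) ^+ 2 / n%:R -
    (1 - 5 * delta) * ((1 + delta) / ((1 - delta) * n%:R)) =
  ((1 - delta) ^+ 2 - (1 - 5 * delta) * (1 + delta) ^+ 3) /
    ((1 + delta) ^+ 2 * (1 - delta) * n%:R).
  by field; rewrite !gt_eqF.
apply: divr_ge0; last by rewrite !mulr_ge0 ?exprn_ge0 ?ltW.
have -> : (1 - delta) ^+ 2 - (1 - 5 * delta) * (1 + delta) ^+ 3 =
  delta ^+ 2 * (13 + 14 * delta + 5 * delta ^+ 2) by ring.
by rewrite mulr_ge0 ?sqr_ge0// !addr_ge0 ?mulr_ge0 ?sqr_ge0 ?ltW.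
Qed.

Lemma balanced_total_degree_gt0 : (0 < \sum_k deg G k)%N.
Proof.
rewrite -(@ltr0n R); apply: lt_le_trans total_degree_ge; exact: mulr_gt0.
Qed.

Lemma balanced_transition_le i j : transition G i j <= delta.
Proof.
rewrite transitionE ler_pdivrMr//.
have d0 := delta_gt0; have := d_ge.
have := ler_wpM2l (ltW delta_gt0) (deg_ge i).
have : 100 * delta * (delta * d) <= 1 * (delta * d).
  by rewrite ler_wpM2r// mulr_ge0 ?ltW.
case: (adj G i j) => /=; lra.
Qed.

(** Cauchy-Schwarz, in the form of a sum of squares of deviations from the
    uniform law. *)
Lemma balanced_sqr_ge : 1 <= n%:R * \sum_i stationary G i ^+ 2 :> R.
Proof.
have pi1 := @stationary_sum1 balanced_total_degree_gt0.
have : 0 <= \sum_i (n%:R * stationary G i - 1) ^+ 2 :> R.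
  by apply: sumr_ge0 => i _; exact: sqr_ge0.
have -> : \sum_i (n%:R * stationary G i - 1) ^+ 2 =
    n%:R * (n%:R * \sum_i stationary G i ^+ 2) - n%:R :> R.
  transitivity (\sum_i (n%:R ^+ 2 * stationary G i ^+ 2
      - 2 * n%:R * stationary G i + 1) : R).
    by apply: eq_bigr => i _; ring.
  rewrite big_split sumrB -!mulr_sumr pi1 sumr_const card_ord /=; ring.
by rewrite -[X in _ - X]mulr1 -mulrBr pmulr_rge0// subr_ge0.
Qed.

Lemma balanced_sqr_le : \sum_i stationary G i ^+ 2 <=
  (1 + delta) / ((1 - delta) * n%:R).
Proof.
have pi1 := @stationary_sum1 balanced_total_degree_gt0.
rewrite -[leRHS]mulr1 -[X in _ <= _ * X]pi1 mulr_sumr; apply: ler_sum => i _.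
by rewrite expr2 ler_wpM2r ?stationary_ge0// balanced_stationary_le.
Qed.

(** The two Kac bounds with kappa = 1 - 5 delta and b = delta; the sum of the
    squares of the stationary weights lies between 1 / n and
    (1 + delta) / ((1 - delta) n). *)
Lemma balanced_meeting_time (W : forall i j, walk_pair R G i j) :
  exists2 t : R, stationary_meeting_time W = t%:E &
    `|n%:R^-1 * t - 1| <= 20 * delta.
Proof.
pose m T : R := pair_mean (stationary G) (capped_time (transition G) T).
have P0 := @WalkPairExistence.tr0 R n G.
have P1 := @WalkPairExistence.tr1 R n G.
have pi1 := @stationary_sum1 balanced_total_degree_gt0.
have dl := delta_le; have dg := delta_gt0.
have kappa0 : 0 < 1 - 5 * delta by lra.
have kappa2 : 1 - 10 * delta <= (1 - 5 * delta) ^+ 2.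
  by rewrite -subr_ge0; have -> : (1 - 5 * delta) ^+ 2 - (1 - 10 * delta) =
    25 * delta ^+ 2 by [ring]; rewrite mulr_ge0 ?sqr_ge0.
have [C CE C3] : exists2 C, 2 / (1 - 5 * delta) ^+ 2 = C & C <= 3.
  exists (2 / (1 - 5 * delta) ^+ 2) => //.
  by rewrite ler_pdivrMr ?exprn_gt0//; lra.
have n2 : 2 <= delta * n%:R.
  by apply: (le_trans d_ge); rewrite ler_pM2l.
set S : R := \sum_(i < n) @stationary R n G i ^+ 2.
have S0 : 0 < S.
  by rewrite -(pmulr_rgt0 _ n_gt0); exact: lt_le_trans balanced_sqr_ge.
have m0 T : 0 <= m T.
  apply: pair_mean_ge0 => [i|i j]; first exact: stationary_ge0.
  exact: capped_time_ge0.
have m_le T : m T <= n%:R * (1 + 20 * delta).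
  have H := pair_mean_upper P0 P1 stationary_ge0 pi1 stationary_transition
    kappa0 balanced_doeblin T balanced_transition_le.
  have {}H : 1 + (1 - 5 * delta) ^+ 2 * m T - delta *
      (m T + C) <= n%:R.
    rewrite -(ler_pM2l S0) -CE; apply: (le_trans H).
    by rewrite mulrC; exact: balanced_sqr_ge.
  have H1 : (1 - 10 * delta) * m T <= (1 - 5 * delta) ^+ 2 * m T by rewrite ler_wpM2r.
  have H2 : delta * C <= delta * 3 by rewrite ler_wpM2l// ltW.
  have H3 : (1 - 11 * delta) * m T <= n%:R by lra.
  have H4 : 0 < 1 - 11 * delta by lra.
  rewrite -(ler_pM2l H4); apply: (le_trans H3).
  rewrite mulrCA -[leLHS]mulr1 ler_pM2l//.
  rewrite -subr_ge0; have -> : (1 - 11 * delta) * (1 + 20 * delta) - 1 =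
    delta * (9 - 220 * delta) by ring.
  by rewrite mulr_ge0 ?ltW//; lra.
have m_low T : 1 + m T - m T.+1 <= S * (m T + 4).
  have H := pair_mean_lower P0 P1 stationary_ge0 pi1 stationary_transition
    kappa0 balanced_doeblin T.
  apply: (le_trans H); apply: ler_wpM2l; first exact: ltW.
  by rewrite -/(m T) CE; lra.
have [t [tE tU tL]] := stationary_meeting_time_lim W m_le m_low.
exists t => //.
have t4 : 0 < t + 4 by rewrite -(pmulr_rgt0 _ S0) (lt_le_trans _ tL).
have {}tL : n%:R * (1 - 6 * delta) <= t.
  have := le_trans tL (ler_wpM2r (ltW t4) balanced_sqr_le).
  rewrite mulrAC ler_pdivlMr ?mulr_gt0// mul1r => H.
  have : (1 - 2 * delta) * (1 + delta) * n%:R <= (1 + delta) * (t + 4).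
    apply: le_trans H; apply: ler_wpM2r; first exact: ltW.
    by have := sqr_ge0 delta; lra.
  by rewrite [(1 - _) * _]mulrC -mulrA ler_pM2l// => H'; lra.
have nV : 0 < n%:R^-1 :> R by rewrite invr_gt0.
have nK : n%:R^-1 * n%:R = 1 :> R by rewrite mulVf ?gt_eqF.
have := ler_wpM2l (ltW nV) tU; have := ler_wpM2l (ltW nV) tL.
by rewrite !mulrA !nK !mul1r ler_norml => H1 H2; apply/andP; split; lra.
Qed.

End graph_chain.

(** * Chernoff bounds and balancedness of random graphs *)

Section chernoff.
Context {R : realType} {V I : finType} (m : V -> R) (K : {set I})
  (B : I -> pred V) (q : R).
Hypothesis m_ge0 : forall v, 0 <= m v.
Hypothesis B_indep : forall S : {set I}, S \subset K ->
  \sum_(v | [forall k in S, B k v]) m v = q ^+ #|S|.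

Definition hits v : nat := (\sum_(k in K) B k v)%N.

(** Turns a product over K into monomials, whose means are all that independence
    provides. *)
Lemma prod_expand (F : I -> R) :
  \prod_(k in K) (1 + F k) = \sum_(S : {set I} | S \subset K) \prod_(k in S) F k.
Proof.
rewrite big_mkcond /=.
transitivity (\prod_k ((if k \in K then F k else 0) + 1)).
  by apply: eq_bigr => k _; case: ifP; rewrite ?add0r// addrC.
rewrite bigA_distr [RHS]big_mkcond /=; apply: eq_bigr => S _.
rewrite -big_mkcond /=; case: ifPn => [/fintype.subsetP SK|/fintype.subsetPn[k kS kK]].
  by apply: eq_bigr => k /SK ->.
by rewrite (bigD1 k)//= (negbTE kK) mul0r.
Qed.

Lemma hits_product_mean x :
  \sum_v m v * \prod_(k in K) (1 + x * (B k v)%:R) = (1 + x * q) ^+ #|K|.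
Proof.
rewrite -prodr_const prod_expand.
under eq_bigr do rewrite prod_expand mulr_sumr.
rewrite exchange_big /=; apply: eq_bigr => S SK.
rewrite prodr_const exprMn -(B_indep SK) mulr_sumr [RHS]big_mkcond /=.
apply: eq_bigr => v _; rewrite big_split /= prodr_const.
case: ifPn => [/forall_inP h|]; first by rewrite big1 ?mulr1 1?mulrC// => k /h ->.
rewrite negb_forall_in => /exists_inP[k kS /negbTE Bk].
by rewrite (bigD1 k)//= Bk mul0r !mulr0.
Qed.

Lemma hits_mgf_le s : 0 <= q <= 1 ->
  \sum_v m v * expR (s * (hits v)%:R) <= expR (#|K|%:R * q * (expR s - 1)).
Proof.
move=> /andP[q0 q1].
have -> : \sum_v m v * expR (s * (hits v)%:R) = (1 + (expR s - 1) * q) ^+ #|K|.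
  rewrite -hits_product_mean; apply: eq_bigr => v _; congr (_ * _).
  rewrite /hits natr_sum mulr_sumr expR_sum; apply: eq_bigr => k _.
  by case: (B k v); rewrite ?mulr1 ?mulr0 ?expR0 ?addr0// addrC subrK.
have -> : #|K|%:R * q * (expR s - 1) = (expR s - 1) * q * #|K|%:R by ring.
rewrite expRM_natr; apply: lerXn2r; rewrite ?nnegrE ?expR_ge0 ?expR_ge1Dx//.
have := expR_ge0 s; nra.
Qed.

(** The exponential Markov inequality; the sign of s selects the tail. *)
Lemma hits_markov s a : 0 <= q <= 1 ->
  \sum_(v | s * a < s * (hits v)%:R) m v <=
  expR (#|K|%:R * q * (expR s - 1) - s * a).
Proof.
move=> q01; rewrite expRD expRN ler_pdivlMr ?expR_gt0//.
apply: le_trans (hits_mgf_le s q01).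
rewrite mulr_suml big_mkcond /=; apply: ler_sum => v _.
case: ifPn => [h|_]; last by rewrite mulr_ge0// expR_ge0.
by rewrite ler_wpM2l// ler_expR ltW.
Qed.

Lemma expR_le_quadratic (s : R) : s <= 1 / 2 -> expR s <= 1 + s + 2 * s ^+ 2.
Proof.
move=> s2; have s1 : 0 < 1 - s by lra.
have : (1 - s) * expR s <= 1.
  rewrite -ler_pdivlMr ?expR_gt0// mul1r -expRN.
  exact: expR_ge1Dx.
move=> h; rewrite -(ler_pM2l s1); apply: (le_trans h).
by have := sqr_ge0 s; nra.
Qed.

Variables (M delta : R).
Hypothesis q01 : 0 <= q <= 1.
Hypothesis K_le : #|K|%:R <= M.
Hypothesis K_ge : (1 - delta / 2) * M <= #|K|%:R.
Hypothesis delta01 : 0 < delta <= 1.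

(** The exponent at s = delta / 4 is at most -delta^2 (M q) / 8; the weaker
    constant 48 is shared with the lower tail. *)
Lemma chernoff_upper :
  \sum_(v | (1 + delta) * (M * q) < (hits v)%:R) m v <=
  expR (- (delta ^+ 2 * (M * q) / 48)).
Proof.
have := q01; have := delta01; have := K_le => KM /andP[d0 d1] /andP[q0 q1].
have s0 : 0 < delta / 4 by lra.
under eq_bigl do rewrite -(ltr_pM2l s0).
apply: (le_trans (hits_markov _ _ q01)); rewrite ler_expR.
have e : expR (delta / 4) <= 1 + delta / 4 + 2 * (delta / 4) ^+ 2.
  by apply: expR_le_quadratic; lra.
have Kq : #|K|%:R * q <= M * q by rewrite ler_wpM2r.
have K0 : 0 <= #|K|%:R * q by rewrite mulr_ge0.
set y := #|K|%:R * q in Kq K0 *; set z := M * q in Kq *.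
have h1 : y * (expR (delta / 4) - 1) <= y * (delta / 4 + 2 * (delta / 4) ^+ 2).
  by rewrite ler_wpM2l//; lra.
have h2 : y * (delta / 4 + 2 * (delta / 4) ^+ 2) <= z * (delta / 4 + 2 * (delta / 4) ^+ 2).
  by rewrite ler_wpM2r// addr_ge0 ?mulr_ge0 ?sqr_ge0 // ltW.
have h3 : 0 <= z * delta ^+ 2 by rewrite mulr_ge0 ?sqr_ge0// (le_trans K0).
lra.
Qed.

(** Here |K| may be smaller than M, as a vertex has only n - 1 possible
    neighbours; [K_ge] lets this cost at most half of delta.  The choice
    s = -delta / 8 gives the exponent -delta^2 (M q) / 32. *)
Lemma chernoff_lower :
  \sum_(v | (hits v)%:R < (1 - delta) * (M * q)) m v <=
  expR (- (delta ^+ 2 * (M * q) / 48)).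
Proof.
have := q01; have := delta01; have := K_le; have := K_ge => Kg KM /andP[d0 d1] /andP[q0 q1].
have s0 : - (delta / 8) < 0 by lra.
under eq_bigl do rewrite -(ltr_nM2l s0).
apply: (le_trans (hits_markov _ _ q01)); rewrite ler_expR.
have e : expR (- (delta / 8)) <= 1 + - (delta / 8) + 2 * (- (delta / 8)) ^+ 2.
  by apply: expR_le_quadratic; lra.
have Kq : #|K|%:R * q <= M * q by rewrite ler_wpM2r.
have Kq' : (1 - delta / 2) * M * q <= #|K|%:R * q by rewrite ler_wpM2r.
have K0 : 0 <= #|K|%:R * q by rewrite mulr_ge0.
rewrite -mulrA in Kq'.
set y := #|K|%:R * q in Kq Kq' K0 *; set z := M * q in Kq Kq' *.
have h1 : y * (expR (- (delta / 8)) - 1) <= y * (- (delta / 8) + 2 * (- (delta / 8)) ^+ 2).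
  by rewrite ler_wpM2l//; lra.
have h2 : y * delta ^+ 2 <= z * delta ^+ 2 by rewrite ler_wpM2r// sqr_ge0.
have h4 : (1 - delta / 2) * z * delta <= y * delta by rewrite ler_wpM2r// ltW.
have h3 : 0 <= z * delta ^+ 2 by rewrite mulr_ge0 ?sqr_ge0// (le_trans K0).
lra.
Qed.

End chernoff.

Section edge_independence.
Context {R : realType} {n : nat} (p : R).

Lemma er_mass_ge0 (G : graph n) : 0 <= p <= 1 -> 0 <= er_mass p G.
Proof.
move=> /andP[p0 p1]; apply: prodr_ge0 => i _; apply: prodr_ge0 => j _.
by rewrite /bernoulli_pmf; case: ifP => // _; lra.
Qed.

Definition upper_triangle (G : graph n) : {ffun 'I_n * 'I_n -> bool} :=
  [ffun e : 'I_n * 'I_n => (e.1 < e.2)%N && adj G e.1 e.2].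

Definition symmetrized (g : {ffun 'I_n * 'I_n -> bool}) : 'M[bool]_n :=
  \matrix_(i, j) if (i < j)%N then g (i, j) else (j < i)%N && g (j, i).

Lemma symmetrized_is_adjacency g : is_adjacency (symmetrized g).
Proof.
apply/andP; split; last by apply/forallP => i; rewrite mxE ltnn.
apply/eqP/matrixP => i j; rewrite !mxE.
by case: ltngtP => // /val_inj ->.
Qed.

(** The adjacency entries above the diagonal are free coordinates of a graph, so
    a sum of products over graphs factorises. *)
Lemma sum_graph_prod (f : 'I_n -> 'I_n -> bool -> R) :
  \sum_(G : graph n) \prod_(i < n) \prod_(j < n | (i < j)%N) f i j (adj G i j) =
  \prod_(i < n) \prod_(j < n | (i < j)%N) (f i j true + f i j false).
Proof.
transitivity (\prod_(e : 'I_n * 'I_n | (e.1 < e.2)%N) \sum_b f e.1 e.2 b); last first.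
  by rewrite pair_big_dep /=; apply: eq_bigr => e _; rewrite big_bool.
rewrite (big_distr_big_dep false) /=.
rewrite (reindex_onto upper_triangle (fun g => Graph (symmetrized_is_adjacency g))) /=.
  apply: eq_big => [G|G _].
    symmetry; apply/andP; split.
      apply/pfamilyP; split=> // ; apply/fintype.subsetP => e.
      rewrite inE ffunE => h; rewrite unfold_in; move: h. by case: (_ < _)%N.
    apply/eqP/val_inj/matrixP => i j; rewrite mxE !ffunE /=.
    case: ltngtP => [//|_|/val_inj ->]; first by rewrite adjC.
    by rewrite adj_irrefl.
  rewrite pair_big_dep /=; apply: eq_bigr => -[i j] /= ij.
  by rewrite ffunE /= ij.
move=> g /pfamilyP[/fintype.subsetP sub _]; apply/ffunP => -[i j]; rewrite ffunE /= mxE.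
case: ltngtP => //= ij; symmetry; apply/negbTE/negP => gij.
  by have := sub (i, j); rewrite inE gij unfold_in /= ltnNge ltnW// => /(_ isT).
by have := sub (i, j); rewrite inE gij unfold_in /= ij ltnn => /(_ isT).
Qed.

Lemma er_prob_edges (F : {set 'I_n * 'I_n}) : (forall e, e \in F -> (e.1 < e.2)%N) ->
  er_prob p (fun G : graph n => [forall e in F, adj G e.1 e.2]) = p ^+ #|F|.
Proof.
move=> F_lt.
pose f i j b := bernoulli_pmf p b * (((i, j) \in F) ==> b)%:R : R.
transitivity (\sum_(G : graph n) \prod_(i < n) \prod_(j < n | (i < j)%N) f i j (adj G i j)).
  rewrite /er_prob big_mkcond /=; apply: eq_bigr => G _; rewrite /f /er_mass.
  under [RHS]eq_bigr do rewrite big_split.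
  rewrite big_split /=; case: ifPn => [/forall_inP h|].
    rewrite [X in _ = _ * X]big1 ?mulr1// => i _; apply: big1 => j _.
    by case: (boolP (_ \in F)) => // /h /= ->.
  rewrite negb_forall_in => /exists_inP[[i j] ijF /= /negbTE ij].
  rewrite [X in _ = _ * X](bigD1 i)//= [X in _ = _ * (X * _)](bigD1 j)/=; last exact: (F_lt _ ijF).
  by rewrite ijF ij !mul0r mulr0.
rewrite sum_graph_prod pair_big_dep /= -prodr_const [RHS]big_mkcond /=.
rewrite big_mkcond /=; apply: eq_bigr => -[i j] _; rewrite /f /bernoulli_pmf /=.
case: (boolP ((i, j) \in F)) => [/F_lt /= ->|_] /=; rewrite ?mulr1 ?mulr0 ?addr0//.
by rewrite addrCA subrr addr0 if_same.
Qed.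

Definition edge (i j : 'I_n) : 'I_n * 'I_n := if (i < j)%N then (i, j) else (j, i).

Lemma adj_edge (G : graph n) i j : adj G (edge i j).1 (edge i j).2 = adj G i j.
Proof. by rewrite /edge; case: ifP => //=; rewrite adjC. Qed.

Lemma edge_lt i j : i != j -> ((edge i j).1 < (edge i j).2)%N.
Proof.
move=> ij; rewrite /edge; case: ifPn => //=; rewrite -leqNgt leq_eqVlt.
by case/predU1P => // /val_inj ji; rewrite ji eqxx in ij.
Qed.

Lemma edge_inj i : injective (edge i).
Proof.
move=> j k; rewrite /edge.
by case: ifPn => [ij|ij]; case: ifPn => [ik|ik] [] // *; subst; move: ij ik;
  rewrite ?ltnn //; case/negP.
Qed.

Lemma er_prob_neighbours i (S : {set 'I_n}) : i \notin S ->
  er_prob p (fun G : graph n => [forall k in S, adj G i k]) = p ^+ #|S|.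
Proof.
move=> iS; rewrite -(card_imset _ (@edge_inj i)) -er_prob_edges; last first.
  by move=> _ /imsetP[k kS ->]; apply: edge_lt; apply: contraNneq iS => ->.
apply: eq_bigl => G; apply/forall_inP/forall_inP.
  by move=> h _ /imsetP[k kS ->]; rewrite adj_edge h.
by move=> h k kS; rewrite -adj_edge h// imset_f.
Qed.

(** The edges from i and from j to S are 2 |S| distinct edges, since neither i
    nor j lies in S. *)
Lemma er_prob_common_neighbours i j (S : {set 'I_n}) :
  i != j -> i \notin S -> j \notin S ->
  er_prob p (fun G : graph n => [forall k in S, adj G i k && adj G j k]) =
  (p ^+ 2) ^+ #|S|.
Proof.
move=> ij iS jS; pose F := (edge i @: S) :|: (edge j @: S).
have cF : #|F| = (2 * #|S|)%N.
  rewrite /F cardsU (card_imset _ (@edge_inj i)) (card_imset _ (@edge_inj j)).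
  rewrite (_ : _ :&: _ = finset.set0) ?finset.cards0 ?subn0 ?mul2n ?addnn//.
  apply/finset.setP => e; rewrite !inE; apply/negbTE/negP => /andP[/imsetP[k kS ->]].
  case/imsetP => l lS; rewrite /edge.
  by do 2!case: ifP => _; case=> e1 e2; move: ij iS jS;
    rewrite ?e1 ?e2 ?eqxx -?e1 -?e2 ?kS ?lS.
rewrite -exprM -cF -er_prob_edges; last first.
  move=> e /finset.setUP[] /imsetP[k kS ->]; apply: edge_lt.
    by apply: contraNneq iS => ->.
  by apply: contraNneq jS => ->.
apply: eq_bigl => G; apply/forall_inP/forall_inP.
  by move=> h e /finset.setUP[] /imsetP[k kS ->]; rewrite adj_edge; case/andP: (h k kS).
move=> h k kS; rewrite -(adj_edge G i) -(adj_edge G j).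
by apply/andP; split; apply: h; rewrite inE imset_f ?orbT.
Qed.

End edge_independence.

Section balanced_prob.
Context {R : realType} {n : nat} (p : R).
Hypothesis p01 : 0 <= p <= 1.

Lemma er_prob_sub (E F : pred (graph n)) :
  (forall G, E G -> F G) -> er_prob p E <= er_prob p F.
Proof.
move=> EF; rewrite /er_prob [leLHS]big_mkcond [leRHS]big_mkcond /=.
apply: ler_sum => G _; case: ifPn => [/EF ->//|_].
by case: ifP => // _; exact: er_mass_ge0.
Qed.

Lemma er_probU (E F : pred (graph n)) :
  er_prob p (fun G => E G || F G) <= er_prob p E + er_prob p F.
Proof.
rewrite /er_prob big_mkcond [X in _ <= X + _]big_mkcond [X in _ <= _ + X]big_mkcond.
rewrite -big_split /=; apply: ler_sum => G _; have := er_mass_ge0 G p01.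
by case: (E G); case: (F G) => /= m0; lra.
Qed.

Lemma er_prob_exists (I : finType) (P : pred I) (E : I -> pred (graph n)) :
  er_prob p (fun G => [exists i, P i && E i G]) <= \sum_(i | P i) er_prob p (E i).
Proof.
rewrite /er_prob; under [leRHS]eq_bigr do rewrite big_mkcond.
rewrite exchange_big big_mkcond /=; apply: ler_sum => G _.
have m0 := er_mass_ge0 G p01.
case: ifPn => [/existsP[i /andP[Pi Ei]]|_]; last first.
  by apply: sumr_ge0 => i _; case: ifP.
rewrite (bigD1 i)//= Ei lerDl; apply: sumr_ge0 => j _; by case: ifP.
Qed.

Context (delta : R).
Hypothesis delta01 : 0 < delta <= 1.
Hypothesis n_ge : 4 <= delta * n%:R.

Lemma deg_hits i (G : graph n) : deg G i = hits [set~ i]%SET (fun j G => adj G i j) G.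
Proof.
rewrite /deg /hits (bigD1 i)//= adj_irrefl add0n; apply: eq_bigl => j.
by rewrite !inE.
Qed.

Lemma codeg_hits i j (G : graph n) :
  codeg G i j = hits (~: [set i; j])%SET (fun k G => adj G i k && adj G j k) G.
Proof.
rewrite /codeg /hits [RHS]big_mkcond /=; apply: eq_bigr => k _; rewrite !inE.
case: eqP => [->|_] /=; first by rewrite adj_irrefl.
by case: eqP => [->|_] //=; rewrite adj_irrefl andbF.
Qed.

Let degree_indep i (S : {set 'I_n}) : S \subset [set~ i]%SET ->
  \sum_(G : graph n | [forall k in S, adj G i k]) er_mass p G = p ^+ #|S|.
Proof.
move=> /fintype.subsetP Si; apply: (er_prob_neighbours p).
by apply/negP => /Si; rewrite !inE eqxx.
Qed.

Let card_degree (i : 'I_n) : (#|[set~ i]%SET| = n.-1)%N.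
Proof. by rewrite cardsC1 card_ord. Qed.

Let card_codegree (i j : 'I_n) : i != j -> (#|(~: [set i; j])%SET| = n - 2)%N.
Proof. by move=> ij; rewrite cardsCs finset.setCK cards2 ij card_ord. Qed.

Let trials_ge k : (k <= 2)%N -> (1 - delta / 2) * n%:R <= (n - k)%:R.
Proof.
move=> k2; have : (n%:R : R) <= (n - k)%:R + 2.
  by rewrite -natrD ler_nat; lia.
by have := n_ge; lra.
Qed.

Lemma degree_upper i :
  er_prob p (fun G : graph n => (1 + delta) * (n%:R * p) < (deg G i)%:R) <=
  expR (- (delta ^+ 2 * (n%:R * p) / 48)).
Proof.
rewrite /er_prob; under eq_bigl do rewrite deg_hits.
apply: (chernoff_upper (fun G => er_mass_ge0 G p01) (@degree_indep i)) => //.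
by rewrite card_degree ler_nat leq_pred.
Qed.

Lemma degree_lower i :
  er_prob p (fun G : graph n => (deg G i)%:R < (1 - delta) * (n%:R * p)) <=
  expR (- (delta ^+ 2 * (n%:R * p) / 48)).
Proof.
rewrite /er_prob; under eq_bigl do rewrite deg_hits.
apply: (chernoff_lower (fun G => er_mass_ge0 G p01) (@degree_indep i)) => //.
  by rewrite card_degree ler_nat leq_pred.
by rewrite card_degree -subn1 trials_ge.
Qed.

Lemma codegree_lower i j : i != j ->
  er_prob p (fun G : graph n => (codeg G i j)%:R < (1 - delta) * (n%:R * p ^+ 2)) <=
  expR (- (delta ^+ 2 * (n%:R * p ^+ 2) / 48)).
Proof.
move=> ij; rewrite /er_prob; under eq_bigl do rewrite codeg_hits.
have indep (S : {set 'I_n}) : S \subset (~: [set i; j])%SET ->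
    \sum_(G : graph n | [forall k in S, adj G i k && adj G j k]) er_mass p G =
    (p ^+ 2) ^+ #|S|.
  move=> /fintype.subsetP Sij; apply: (er_prob_common_neighbours p ij).
    by apply/negP => /Sij; rewrite !inE eqxx.
  by apply/negP => /Sij; rewrite !inE eqxx orbT.
apply: (chernoff_lower (fun G => er_mass_ge0 G p01) indep) => //.
- by have /andP[p0 p1] := p01; rewrite exprn_ge0//= expr_le1.
- by rewrite card_codegree// ler_nat leq_subr.
- by rewrite card_codegree// trials_ge.
Qed.

(** A union bound; the factor 2 in front of n counts both tails of the degrees,
    and the one in front of the binomial turns unordered into ordered pairs. *)
Lemma balanced_prob :
  er_prob p (fun G : graph n => ~~ `[< balanced G (n%:R * p) delta >]) <=
  2 * n%:R * expR (- (delta ^+ 2 * (n%:R * p) / 48)) +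
  2 * 'C(n, 2)%:R * expR (- (delta ^+ 2 * ((n%:R * p) ^+ 2 / n%:R) / 48)).
Proof.
have n0 : (0 < n)%N.
  rewrite lt0n; apply/eqP => n0; have := n_ge; rewrite n0 mulr0.
  by rewrite lern0.
have dE : (n%:R * p) ^+ 2 / n%:R = n%:R * p ^+ 2.
  by field; rewrite pnatr_eq0 -lt0n.
pose low i (G : graph n) := (deg G i)%:R < (1 - delta) * (n%:R * p).
pose high i (G : graph n) := (1 + delta) * (n%:R * p) < (deg G i)%:R.
pose few (e : 'I_n * 'I_n) (G : graph n) :=
  (codeg G e.1 e.2)%:R < (1 - delta) * (n%:R * p ^+ 2).
apply: (@le_trans _ _ (er_prob p (fun G =>
   ([exists i, xpredT i && low i G] || [exists i, xpredT i && high i G]) ||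
   [exists e, (e.1 != e.2) && few e G]))).
  apply: er_prob_sub => G; apply: contraNT; rewrite !negb_or => /andP[/andP[]].
  move=> /existsPn Hl /existsPn Hh /existsPn Hf; apply/asboolP; split.
    by move=> i; rewrite !leNgt; apply/andP; split; [exact: Hl|exact: Hh].
  by move=> i j ij; have := Hf (i, j); rewrite dE /= ij /= -leNgt.
apply: (le_trans (er_probU _ _)); apply: lerD.
  apply: (le_trans (er_probU _ _)).
  rewrite -mulrA [2]mulr2n mulrDl mul1r; set b := expR _.
  have bE : n%:R * b = \sum_(i < n) b by rewrite sumr_const card_ord mulr_natl.
  rewrite bE; apply: lerD; apply: (le_trans (er_prob_exists _ _)).
    by apply: ler_sum => i _; exact: degree_lower.
  by apply: ler_sum => i _; exact: degree_upper.
apply: (le_trans (er_prob_exists _ _)).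
rewrite dE.
apply: (@le_trans _ _ (\sum_(e : 'I_n * 'I_n | e.1 != e.2)
    expR (- (delta ^+ 2 * (n%:R * p ^+ 2) / 48)))).
  by apply: ler_sum => e; exact: codegree_lower.
rewrite -(pair_big_dep xpredT (fun i j : 'I_n => i != j)
  (fun _ _ => expR (- (delta ^+ 2 * (n%:R * p ^+ 2) / 48)))) /=.
have -> : 2 * 'C(n, 2)%:R = (n * n.-1)%:R :> R.
  by rewrite -natrM mulnC -[2%N]/(2`!) bin_ffact ffactnS ffactn1.
rewrite (eq_bigr (fun=> n.-1%:R * expR (- (delta ^+ 2 * (n%:R * p ^+ 2) / 48)))).
  by rewrite sumr_const card_ord -[leLHS]mulr_natl mulrA -natrM.
move=> i _; rewrite sumr_const -[LHS]mulr_natl; congr (_%:R * _).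
rewrite -[RHS](card_degree i); apply: eq_card => j.
by rewrite !inE eq_sym.
Qed.

End balanced_prob.

(** * Growth of the mean degree and the deviation bound *)

Section asymptotics.
Context {R : realType}.

(** From exp x >= (x / k)^k, with k so large that (n^g)^k >= n^3. *)
Lemma stretched_exp_decay (a g : R) : 0 < a -> 0 < g ->
  exists C : R, forall n, (0 < n)%N ->
    n%:R ^+ 3 * expR (- (a * n%:R `^ g)) <= C.
Proof.
move=> a0 g0.
have [k k0 gk] : exists2 k, (0 < k)%N & 3 <= g * k%:R.
  exists (Num.truncn (3 / g)).+1 => //.
  by rewrite mulrC -ler_pdivrMr//; exact/ltW/Num.Theory.truncnS_gt.
have kR : 0 < k%:R :> R by rewrite ltr0n.
exists ((k%:R / a) ^+ k) => n n0; have n1 : 1 <= n%:R :> R by rewrite ler1n.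
rewrite expRN ler_pdivrMr ?expR_gt0//.
have -> : a * n%:R `^ g = (a / k%:R * n%:R `^ g) * k%:R by field; rewrite gt_eqF.
rewrite expRM_natr -exprMn.
have base : n%:R `^ g <= k%:R / a * expR (a / k%:R * n%:R `^ g).
  apply: (@le_trans _ _ (k%:R / a * (a / k%:R * n%:R `^ g))).
    by rewrite mulrA [_ / _ * _](_ : _ = 1) ?mul1r//; field; rewrite !gt_eqF.
  apply: ler_wpM2l; first by rewrite divr_ge0// ltW.
  by apply: le_trans (expR_ge1Dx _); rewrite lerDr.
apply: (@le_trans _ _ ((n%:R `^ g) ^+ k)); last first.
  by apply: lerXn2r => //; rewrite nnegrE ?powR_ge0// (le_trans _ base) ?powR_ge0.
by rewrite -[leRHS]powR_mulrn ?powR_ge0// -powRrM -powR_mulrn// ler_powR.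
Qed.

Section sparse.
Context (c beta : R).
Hypothesis c_gt0 : 0 < c.
Hypothesis beta_gt : 2^-1 < beta.

(** The exponent of the growth of d^2 / n: it is min(2 beta - 1, 1), since
    the edge probability stops growing at 1. *)
Definition gap : R := 1 + 2 * Num.min (beta - 1) 0.

Lemma gap_gt0 : 0 < gap.
Proof.
have b2 : 1 < 2 * beta by rewrite -ltr_pdivrMl// mulr1.
by rewrite /gap; case: (leP (beta - 1) 0) => h; lra.
Qed.

Lemma edge_prob01 n : 0 <= edge_prob c beta n <= 1.
Proof.
by rewrite /edge_prob ge_min lexx orbT andbT le_min ler01 andbT
  mulr_ge0 ?powR_ge0// ltW.
Qed.

Lemma mean_degree_le n : mean_degree c beta n <= n%:R.
Proof. by have /andP[_ p1] := edge_prob01 n; rewrite -[leRHS]mulr1 ler_wpM2l. Qed.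

Lemma mean_codegree_le n : mean_degree c beta n ^+ 2 / n%:R <= mean_degree c beta n.
Proof.
case: n => [|n]; first by rewrite /mean_degree !mul0r expr2 !mul0r.
have /andP[p0 p1] := edge_prob01 n.+1.
rewrite ler_pdivrMr ?ltr0n// expr2 ler_wpM2l ?mean_degree_le//.
by rewrite mulr_ge0.
Qed.

Lemma mean_codegree_ge n : (0 < n)%N ->
  Num.min c 1 ^+ 2 * n%:R `^ gap <= mean_degree c beta n ^+ 2 / n%:R.
Proof.
move=> n0; have nR : 0 < n%:R :> R by rewrite ltr0n.
have n1 : 1 <= n%:R :> R by rewrite ler1n.
have -> : mean_degree c beta n ^+ 2 / n%:R = n%:R * edge_prob c beta n ^+ 2.
  by rewrite /mean_degree; field; rewrite gt_eqF.
set b := Num.min (beta - 1) 0.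
have c1 : 0 < Num.min c 1 by rewrite lt_min c_gt0 ltr01.
have p_ge : Num.min c 1 * n%:R `^ b <= edge_prob c beta n.
  rewrite /edge_prob le_min; apply/andP; split.
    apply: ler_pM; rewrite ?powR_ge0 ?(ltW c1) ?ge_min ?lexx//.
    by rewrite ler_powR// ge_min lexx.
  rewrite -[leRHS]mulr1; apply: ler_pM; rewrite ?powR_ge0 ?(ltW c1) ?ge_min ?lexx ?orbT//.
  by rewrite -[leRHS](powRr0 n%:R) ler_powR// ge_min lexx orbT.
have -> : n%:R `^ gap = n%:R * (n%:R `^ b) ^+ 2.
  rewrite /gap -/b powRD; last by rewrite (gt_eqF nR) implybT.
  by rewrite powRr1 ?ltW// mulrC [2 * b]mulrC powRrM powR_mulrn ?powR_ge0// mulrC.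
rewrite mulrCA -exprMn; apply: ler_wpM2l; first exact: ltW.
by apply: lerXn2r; rewrite ?nnegrE ?mulr_ge0 ?powR_ge0 ?(ltW c1)//;
  case/andP: (edge_prob01 n).
Qed.

Lemma mean_degree_ge_near (A : R) : exists N, forall n, (N <= n)%N ->
  A <= mean_degree c beta n.
Proof.
have g0 := gap_gt0.
have c1 : 0 < Num.min c 1 ^+ 2 by rewrite exprn_gt0// lt_min c_gt0 ltr01.
set B := `|A| / Num.min c 1 ^+ 2.
have B0 : 0 <= B by rewrite divr_ge0// ltW.
exists (Num.truncn (B `^ gap^-1)).+1 => n Nn.
have n0 : (0 < n)%N by apply: leq_trans Nn.
apply: (le_trans _ (le_trans (mean_codegree_ge n0) (mean_codegree_le n))).
apply: (le_trans (ler_norm A)); rewrite mulrC -ler_pdivrMr// -/B.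
have h : B `^ gap^-1 <= n%:R.
  apply: le_trans (ltW (Num.Theory.truncnS_gt _)) _; by rewrite ler_nat.
apply: (@le_trans _ _ ((B `^ gap^-1) `^ gap)).
  by rewrite -powRrM mulVf ?gt_eqF// powRr1.
by rewrite ge0_ler_powR ?nnegrE ?powR_ge0// ltW.
Qed.

Lemma deviation_bound_cvg (nu1 nu2 theta : R) : 0 < nu1 -> 0 < nu2 -> 0 < theta ->
  deviation_bound c beta nu1 nu2 theta n @[n --> \oo] --> (0 : R).
Proof.
move=> nu10 nu20 theta0.
have c1 : 0 < Num.min c 1 ^+ 2 by rewrite exprn_gt0// lt_min c_gt0 ltr01.
pose a1 := nu1 ^+ 2 / 3 * Num.min c 1 ^+ 2.
pose a2 := nu2 ^+ 2 / 3 * Num.min c 1 ^+ 2.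
have a1_gt0 : 0 < a1 by rewrite mulr_gt0// divr_gt0// exprn_gt0.
have a2_gt0 : 0 < a2 by rewrite mulr_gt0// divr_gt0// exprn_gt0.
have [C1 hC1] := stretched_exp_decay a1_gt0 gap_gt0.
have [C2 hC2] := stretched_exp_decay a2_gt0 gap_gt0.
apply/cvgrPdist_lt => e e0.
have [A A1 Ae] : exists2 A, 1 <= A & 2 / e <= theta * A.
  exists (1 + 2 / (e * theta)); first by rewrite lerDl divr_ge0// ltW// mulr_gt0.
  have -> : theta * (1 + 2 / (e * theta)) = theta + 2 / e.
    by field; rewrite !gt_eqF.
  by rewrite lerDr ltW.
near=> n.
have n1 : 1 <= n%:R :> R by near: n; exact: nbhs_infty_ger.
have n0 : (0 < n)%N by rewrite -(ltr0n R) (lt_le_trans _ n1).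
have nR : 0 < n%:R :> R by rewrite ltr0n.
have low := mean_codegree_ge n0.
have low' := le_trans low (mean_codegree_le n).
set d := mean_degree c beta n in low low'.
have t1 : n%:R * expR (- (nu1 ^+ 2 * d / 3)) * n%:R <= C1.
  apply: le_trans (hC1 n n0).
  rewrite mulrAC; apply: ler_pM; rewrite ?mulr_ge0 ?expR_ge0//.
    by rewrite -expr2 ler_weXn2l.
  rewrite ler_expR lerN2 /a1.
  have -> : nu1 ^+ 2 * d / 3 = nu1 ^+ 2 / 3 * d by ring.
  by rewrite -mulrA ler_wpM2l// divr_ge0// exprn_ge0// ltW.
have t2 : 'C(n, 2)%:R * expR (- (nu2 ^+ 2 * d ^+ 2 / (3 * n%:R))) * n%:R <= C2.
  apply: le_trans (hC2 n n0).
  rewrite mulrAC; apply: ler_pM; rewrite ?mulr_ge0 ?expR_ge0//.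
    rewrite exprSr ler_wpM2r// -natrX ler_nat bin2.
    by rewrite -divn2 (leq_trans (leq_div _ _))// leq_mul2l leq_pred orbT.
  rewrite ler_expR lerN2 /a2.
  have -> : nu2 ^+ 2 * d ^+ 2 / (3 * n%:R) = nu2 ^+ 2 / 3 * (d ^+ 2 / n%:R).
    by field; rewrite gt_eqF.
  by rewrite -mulrA ler_wpM2l// divr_ge0// exprn_ge0// ltW.
have t3 : expR (- (theta * ln n%:R ^+ 2)) < e / 2.
  have An : A <= ln n%:R.
    have eAn : expR A <= n%:R by near: n; exact: nbhs_infty_ger.
    by rewrite -(expRK A) ler_ln// posrE expR_gt0.
  have sq : theta * A <= theta * ln n%:R ^+ 2.
    by rewrite ler_pM2l// expr2 -[leLHS]mulr1; apply: ler_pM => //; lra.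
  rewrite expRN -[ltRHS]invrK ltf_pV2 ?posrE ?expR_gt0 ?invr_gt0 ?divr_gt0//.
  rewrite invf_div; apply: lt_le_trans (expR_ge1Dx _).
  by apply: (le_lt_trans (le_trans Ae sq)); rewrite ltrDr.
have t12 : 2 * C1 + 2 * C2 < e / 2 * n%:R.
  rewrite -ltr_pdivrMl ?divr_gt0//.
  near: n; exact: nbhs_infty_gtr.
rewrite sub0r normrN ger0_norm; last first.
  by rewrite /deviation_bound !addr_ge0 ?mulr_ge0 ?expR_ge0.
rewrite /deviation_bound -/d -(ltr_pM2r nR) mulrDl.
have t3n : expR (- (theta * ln n%:R ^+ 2)) * n%:R < e / 2 * n%:R by rewrite ltr_pM2r.
lra.
Unshelve. all: by end_near. Qed.

End sparse.
End asymptotics.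

(** * Concentration of the meeting time *)

Theorem theorem1p3 (R : realType) (c beta : R) (hc : 0 < c)
    (hbeta : 2^-1 < beta) (eps : R) (heps : 0 < eps) :
  exists (N : nat) (nu1 nu2 theta : R),
    [/\ 0 < nu1, 0 < nu2, 0 < theta,
        forall n : nat, (N <= n)%N ->
        forall W : forall (G : graph n) (i j : 'I_n), walk_pair R G i j,
          er_prob (edge_prob c beta n)
            (fun G : graph n =>
               (eps%:E < `| n%:R^-1%:E * stationary_meeting_time (W G) - 1 |)%E)
          <= deviation_bound c beta nu1 nu2 theta n
      & deviation_bound c beta nu1 nu2 theta n @[n --> \oo] --> (0 : R)].
Proof.
(* 20 delta bounds the relative error on balanced graphs, which is controlled
   for delta up to 1 / 100. *)
pose delta := Num.min (eps / 20) (1 / 100) : R.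
have delta_gt0 : 0 < delta by rewrite lt_min !divr_gt0.
have delta_eps : 20 * delta <= eps.
  by rewrite mulrC -ler_pdivlMr// ge_min lexx.
have delta_le : 100 * delta <= 1.
  by rewrite mulrC -ler_pdivlMr// ge_min lexx orbT.
(* As d <= n, this makes n large enough as well. *)
have [N hN] := mean_degree_ge_near hc hbeta (4 / delta).
have nu0 : 0 < delta / 4 by rewrite divr_gt0.
exists N, (delta / 4), (delta / 4), 1; split=> //; last exact: deviation_bound_cvg.
move=> n /hN; rewrite ler_pdivrMr// mulrC => d4 W.
set d := mean_degree c beta n in d4.
have dn : d <= n%:R by exact: mean_degree_le.
have p01 := edge_prob01 beta hc n.
have delta01 : 0 < delta <= 1 by rewrite delta_gt0 /=; lra.
have n4 : 4 <= delta * n%:R by apply: (le_trans d4); rewrite ler_pM2l.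
have n0 : n%:R != 0 :> R by apply: contraTneq n4 => ->; rewrite mulr0 -ltNge.
apply: (@le_trans _ _ (er_prob (edge_prob c beta n)
    (fun G : graph n => ~~ `[< balanced G d delta >]))).
  apply: (er_prob_sub p01) => G; apply: contraTN => /asboolP bal.
  have d2 : 2 <= delta * d by lra.
  have [t -> dev] := balanced_meeting_time delta_gt0 delta_le d2 dn bal (W G).
  rewrite -EFinM -EFinB /= lte_fin -leNgt; exact: le_trans dev delta_eps.
apply: (le_trans (balanced_prob p01 delta01 n4)).
rewrite /deviation_bound -/d -[n%:R * _]/d.
have -> : (delta / 4) ^+ 2 * d / 3 = delta ^+ 2 * d / 48 by field.
have -> : (delta / 4) ^+ 2 * d ^+ 2 / (3 * n%:R) = delta ^+ 2 * (d ^+ 2 / n%:R) / 48.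
  by field.
by rewrite lerDl expR_ge0.
Qed.
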